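(* Let $n\ge1$ and let $\mathcal{B}_n$ be the arrangement in $\mathbb{R}^n$ with hyperplanes $$x_i=-\tfrac32,-\tfrac12,\tfrac12\ (1\le i\le n),\qquad x_i+x_j=-2,-1,0,\qquad x_i-x_j=-1,0,1\ (1\le i<j\le n).$$ The number of type $B$ sketches, which is the number of regions of $\mathcal{B}_n$, is $$2^n\,n!\binom{2n}{n}.$$
   Context: A region of an arrangement is a connected component of the complement of the union of its hyperplanes. $[n]=\{1,\dots,n\}$. $\mathcal{B}_n$ is the translate (by $X_i=x_i+\tfrac12$) of the type $B$ Catalan arrangement $X_i=-1,0,1$; $X_i\pm X_j=-1,0,1$. Let $B(n)$ be the set of $4n+4$ letters $\alpha_i^{(s)}$ and $\alpha_{-i}^{(-s)}$ ($i\in[n]$, $s\in\{0,1\}$) together with $\alpha_-^{(-1.5)},\alpha_-^{(-0.5)},\alpha_+^{(0.5)},\alpha_+^{(1.5)}$. Here $\alpha_i^{(s)}$ represents $x_i+s$, $\alpha_{-i}^{(-s)}$ represents $-x_i-s$, and the last four letters represent the numbers $-\tfrac32,-\tfrac12,\tfrac12,\tfrac32$ respectively. A pointed symmetric sketch is a total order on $B(n)$ (written as a word) for which there is a point $(x_1,\dots,x_n)\in\mathbb{R}^n$ such that the represented real numbers are strictly increasing along the word. To a pointed symmetric sketch one associates its pointed $\alpha,\beta$-word, of length $2n+2$: for each of the first $2n+2$ letters of the sketch (its first half), write $\alpha$ if the letter is of the form $\alpha_i^{(0)}$, $\alpha_{-i}^{(-1)}$ ($i\in[n]$) or $\alpha_-^{(-1.5)}$,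 and write $\beta$ otherwise; the $\beta$ coming from $\alpha_-^{(-0.5)}$ is marked (''pointed to''). A type $B$ sketch is a pointed symmetric sketch whose pointed $\alpha,\beta$-word has last letter $\beta$ and is such that the letter immediately after its $(n+1)$-th $\alpha$ is the pointed $\beta$. *)

(* Defs.v *)
From HB Require Import structures.
From mathcomp Require Import all_boot all_order all_algebra.
From mathcomp Require Import all_classical all_reals topology normedtype.

Set Implicit Arguments.
Unset Strict Implicit.
Unset Printing Implicit Defensive.

Import Order.TTheory GRing.Theory Num.Theory.
Import numFieldNormedType.Exports.

Local Open Scope classical_set_scope.
Local Open Scope ring_scope.

Definition arrangement_complement (T : Type) (A : set (set T)) : set T :=
  ~` \bigcup_(H in A) H.

Definition regions (T : topologicalType) (A : set (set T)) : set (set T) :=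
  [set connected_component (arrangement_complement A) x
     | x in arrangement_complement A].

Definition arrangement_B (R : realType) (n : nat) : set (set 'rV[R]_n) :=
  [set H | exists i : 'I_n,
     exists2 c : R, c \in [:: - (3 / 2); - (1 / 2); 1 / 2] &
       H = [set x : 'rV[R]_n | x 0 i = c]] `|`
  [set H | exists i j : 'I_n, (i < j)%N /\
     exists2 c : R, c \in [:: -2; -1; 0] &
       H = [set x : 'rV[R]_n | x 0 i + x 0 j = c]] `|`
  [set H | exists i j : 'I_n, (i < j)%N /\
     exists2 c : R, c \in [:: -1; 0; 1] &
       H = [set x : 'rV[R]_n | x 0 i - x 0 j = c]].

(* [pos_letter i s] is $\alpha_i^{(s)}$ and [neg_letter i s] is
   $\alpha_{-i}^{(-s)}$, where [s : bool] stands for the shift 0 or 1.  The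
   four others are $\alpha_-^{(-1.5)}, \alpha_-^{(-0.5)}, \alpha_+^{(0.5)},
   \alpha_+^{(1.5)}$, in this order. *)
Inductive letter (n : nat) : Type :=
| pos_letter of 'I_n & bool
| neg_letter of 'I_n & bool
| minus_three_halves
| minus_half
| plus_half
| plus_three_halves.

Arguments minus_three_halves {n}.
Arguments minus_half {n}.
Arguments plus_half {n}.
Arguments plus_three_halves {n}.

Definition letter_code n (a : letter n) :
    ('I_n * bool) + ('I_n * bool) + (bool * bool) :=
  match a with
  | pos_letter i s => inl (inl (i, s))
  | neg_letter i s => inl (inr (i, s))
  | minus_three_halves => inr (false, true)
  | minus_half => inr (false, false)
  | plus_half => inr (true, false)
  | plus_three_halves => inr (true, true)
  end.

Definition letter_decode n
    (c : ('I_n * bool) + ('I_n * bool) + (bool * bool)) : letter n :=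
  match c with
  | inl (inl (i, s)) => pos_letter i s
  | inl (inr (i, s)) => neg_letter i s
  | inr (false, true) => minus_three_halves
  | inr (false, false) => minus_half
  | inr (true, false) => plus_half
  | inr (true, true) => plus_three_halves
  end.

Lemma letter_codeK n : cancel (@letter_code n) (@letter_decode n).
Proof. by case. Qed.

Lemma letter_decodeK n : cancel (@letter_decode n) (@letter_code n).
Proof. by move=> [[[? ?]|[? ?]]|[[] []]]. Qed.

HB.instance Definition _ n :=
  Finite.copy (letter n) (can_type (@letter_codeK n)).

Lemma card_letter n : #|{: letter n}| = (4 * n + 4)%N.
Proof.
rewrite (bij_eq_card (Bijective (@letter_codeK n) (@letter_decodeK n))).
by rewrite !card_sum !card_prod !card_ord !card_bool -mulnDr mulnC.
Qed.

Definition letter_val (R : realType) n (x : 'rV[R]_n) (a : letter n) : R :=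
  match a with
  | pos_letter i s => x 0 i + s%:R
  | neg_letter i s => - x 0 i - s%:R
  | minus_three_halves => - (3 / 2)
  | minus_half => - (1 / 2)
  | plus_half => 1 / 2
  | plus_three_halves => 3 / 2
  end.

(* A total order on the letters is a word in which each letter occurs exactly
   once. *)
Definition pointed_symmetric_sketch (R : realType) n (w : seq (letter n)) :
    Prop :=
  perm_eq w (enum {: letter n}) /\
  exists x : 'rV[R]_n,
    sorted (fun a b => letter_val x a < letter_val x b) w.

Inductive ab_letter : Type := alpha | beta | pointed_beta.

Definition is_alpha (c : ab_letter) : bool :=
  if c is alpha then true else false.

Definition is_beta (c : ab_letter) : bool := ~~ is_alpha c.

Definition ab_of_letter n (a : letter n) : ab_letter :=
  match a with
  | pos_letter _ false | neg_letter _ true | minus_three_halves => alpha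
  | minus_half => pointed_beta
  | _ => beta
  end.

Definition ab_word n (w : seq (letter n)) : seq ab_letter :=
  [seq ab_of_letter a | a <- take (2 * n + 2) w].

Definition type_B_sketch (R : realType) n (w : seq (letter n)) : Prop :=
  [/\ pointed_symmetric_sketch R w,
      (exists u c, ab_word w = rcons u c /\ is_beta c) &
      exists u v, ab_word w = u ++ [:: alpha, pointed_beta & v] /\
        count is_alpha u = n].

Definition type_B_sketches (R : realType) (n : nat) : set (seq (letter n)) :=
  [set w | type_B_sketch R w].

Arguments arrangement_B R n : clear implicits.
Arguments type_B_sketches R n : clear implicits.

(* Main.v *)
Require Import Defs.
From mathcomp Require Import all_boot all_order all_algebra.
From mathcomp Require Import all_classical all_reals topology normedtype.
From mathcomp Require Import zify lra ring.

Set Implicit Arguments.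
Unset Strict Implicit.
Unset Printing Implicit Defensive.

Import Order.TTheory GRing.Theory Num.Theory.
Import numFieldNormedType.Exports.

(* Put X_i = x_i + 1/2.  Both counts split off a free action of the 2^n n! signed
   permutations, and it remains to count the sign patterns of an increasing
   sequence 0 < y_0 < ... < y_(n-1) of magnitudes |X_i|.  Such a pattern is encoded
   by three pieces of data: the number r of terms below 1; for every j >= r the
   number a_j <= j of terms below y_j - 1, which is nondecreasing in j; and r - 1
   bits comparing with 1 the sums of two terms below 1: the first bit compares
   y_0 + y_(r-1), which decides all sums involving one of these two extreme terms,
   and the next bits continue on the remaining interval.  Every such code is
   realized, and the number of codes is a telescoping sum of ballot numbers,
       sum_r 2^max(r-1, 0) ('C(2n-r, n) - 'C(2n-r, n+1)) = 'C(2n, n).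
   Type B sketches are not in natural bijection with regions (some regions contain
   the points of several of them, others of none), but they have the same codes.
   Of the two conditions on the word, the last letter being beta says that the
   magnitude below 1 closest to 1/2 exceeds 1/2, and the position of the pointed
   beta says that no magnitude lies between 1 and 1 + min(y_0, 1).  The a_j are now
   read off the list of the y_i and 1 with its smallest term dropped. *)

(** * Codes *)

(** The ceiling rises by one at each term, so these are ballot-type lattice paths. Both bounds are
    kept general because splitting on the first term changes both of them. *)
Fixpoint stairs (k lo hi : nat) : seq (seq nat) :=
  if k is k'.+1 then
    [seq c :: s | c <- iota lo (hi.+1 - lo), s <- stairs k' c hi.+1]
  else [:: [::]].

Lemma mem_stairs k lo hi s :
  (s \in stairs k lo hi) =
  [&& size s == k, path leq lo s & all (fun i => nth 0 s i <= hi + i) (iota 0 k)].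
Proof.
elim: k lo hi s => [|k IHk] lo hi s.
  by rewrite inE /=; case: s => //= *; rewrite ?andbT.
apply/allpairsPdep/idP => [[c [t [cin tin ->]]]|].
  move: tin; rewrite IHk mem_iota in cin * => /and3P[/eqP st pt /allP at_].
  rewrite /= st eqxx /= pt andbT addn0.
  apply/andP; split; first by lia.
  apply/andP; split; first by lia.
  apply/allP => i; rewrite mem_iota => ilt.
  case: i ilt => [|i] ilt //=.
  by have := at_ i; rewrite mem_iota /=; move=> /(_ ltac:(lia)); lia.
case: s => [//|c t] /and3P[/eqP [st] /= /andP[lc pt] /andP[ch /allP at_]].
exists c, t; split => //; first by rewrite mem_iota; lia.
rewrite IHk st eqxx pt /=.
apply/allP => i; rewrite mem_iota => ilt.
by have := at_ i.+1; rewrite mem_iota /=; move=> /(_ ltac:(lia)); lia.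
Qed.

Lemma stairs_uniq k lo hi : uniq (stairs k lo hi).
Proof.
elim: k lo hi => [//|k IHk] lo hi /=.
apply: allpairs_uniq_dep => //; first exact: iota_uniq.
by move=> [c s] [c' s'] _ _ /= [-> ->].
Qed.

(** The reflection formula for ballot paths, written additively because subtraction on naturals
    truncates. The induction is on [k] and then on [h]: separating the sequences that start at [lo]
    from the others leads to Pascal's rule. *)
Lemma size_stairs k lo h :
  size (stairs k lo (lo + h)) + 'C(2 * k + h, k + h + 1) = 'C(2 * k + h, k + h).
Proof.
elim: k lo h => [|k IHk] lo h.
  by rewrite muln0 !add0n binn bin_small ?addn1.
have E : size (stairs k.+1 lo (lo + h)) =
    sumn [seq size (stairs k (lo + t) (lo + h).+1) | t <- iota 0 h.+1].
  rewrite [LHS]size_allpairs_dep (_ : _ - _ = h.+1); last lia.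
  rewrite (_ : iota lo h.+1 = [seq lo + t | t <- iota 0 h.+1]) -?map_comp //.
  by rewrite -iotaDl addn0.
rewrite {}E; elim: h lo => [|h IHh] lo.
  rewrite /= !addn0; have := IHk lo 1; rewrite !addn1 => E.
  move: (binS (2 * k).+1 k.+1) (binS (2 * k).+1 k).
  have -> : 2 * k.+1 = (2 * k).+2 by lia.
  (* For [h = 0], Pascal's rule leaves the two central binomials of an odd row, equal by
     symmetry. *)
  rewrite (_ : 'C((2 * k).+1, k) = 'C((2 * k).+1, k.+1)).
    by move: E; lia.
  by rewrite -bin_sub ?ltnS; [congr 'C(_, _); lia | lia].
(* The sequences whose first term is above [lo] are those of the sum for [lo.+1] and [h], under the
   same ceiling. *)
have -> : sumn [seq size (stairs k (lo + t) (lo + h.+1).+1) | t <- iota 0 h.+2] =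
  size (stairs k lo (lo + h.+2)) +
  sumn [seq size (stairs k (lo.+1 + t) (lo.+1 + h).+1) | t <- iota 0 h.+1].
  rewrite /=; congr (size (stairs _ _ _) + (size (stairs _ _ _) + _)); try lia.
  rewrite !(iotaDl 1 1) -!map_comp; congr sumn; apply: eq_map => t /=.
  by congr (size (stairs _ _ _)); lia.
have := IHk lo h.+2; have := IHh lo.+1.
move: (size _) (sumn _) => A B.
have -> : 2 * k.+1 + h = 2 * k + h.+2 by lia.
have -> : 2 * k.+1 + h.+1 = (2 * k + h.+2).+1 by lia.
have -> : k.+1 + h + 1 = k + h.+2 by lia.
have -> : k.+1 + h = (k + h).+1 by lia.
have -> : k.+1 + h.+1 + 1 = (k + h.+2).+1 by lia.
have -> : k.+1 + h.+1 = (k + h).+2 by lia.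
have -> : k + h.+2 = (k + h).+2 by lia.
rewrite !binS addn1; lia.
Qed.

Definition codes (n : nat) : seq (nat * (seq nat * seq bool)) :=
  [seq (r, p) | r <- iota 0 n.+1,
     p <- [seq (a, v) | a <- stairs (n - r) 0 r,
                        v <- [seq val t | t <- enum {: r.-1.-tuple bool}]]].

Lemma mem_codes n r a v :
  ((r, (a, v)) \in codes n) = [&& r <= n, a \in stairs (n - r) 0 r & size v == r.-1].
Proof.
apply/allpairsPdep/idP => [[r' [p [rn /allpairsPdep[a' [v' [ain vin ->]]] [-> -> ->]]]]|].
  case/mapP: vin => t _ ->; rewrite ain size_tuple eqxx andbT.
  by move: rn; rewrite mem_iota; lia.
case/and3P => rn ain sv; exists r, (a, v); split => //; first by rewrite mem_iota; lia.
apply/allpairsPdep; exists a, v; split => //.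
by apply/mapP; exists (Tuple sv) => //; rewrite mem_enum.
Qed.

Lemma codes_uniq n : uniq (codes n).
Proof.
apply: allpairs_uniq_dep; first exact: iota_uniq.
  move=> r _; apply: allpairs_uniq_dep; first exact: stairs_uniq.
    by move=> a _; rewrite map_inj_uniq ?enum_uniq //; apply: val_inj.
  by move=> [c s] [c' s'] _ _ /= [-> ->].
by move=> [c s] [c' s'] _ _ /= [-> ->].
Qed.

Lemma size_codes n : size (codes n) = 'C(2 * n, n).
Proof.
rewrite size_allpairs_dep.
pose F r := size (stairs (n - r) 0 r) * 2 ^ r.-1.
have -> : sumn [seq size [seq (a, v) | a <- stairs (n - r) 0 r,
     v <- [seq val t | t <- enum {: r.-1.-tuple bool}]] | r <- iota 0 n.+1]
   = sumn [seq F r | r <- iota 0 n.+1].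
  congr sumn; apply: eq_map => r; rewrite size_allpairs /F.
  by rewrite size_map -cardE card_tuple card_bool.
have Fr r : r <= n -> size (stairs (n - r) 0 r) + 'C(2 * n - r, n.+1) = 'C(2 * n - r, n).
  move=> rn; have := size_stairs (n - r) 0 r; rewrite add0n.
  have -> : n - r + r = n by lia.
  by rewrite addn1 (_ : 2 * (n - r) + r = 2 * n - r) //; lia.
(* By Pascal's rule the term [r = k + 1] together with the remainder for [k + 1] gives the remainder
   for [k]; at [k = n] the remainder vanishes. The term [r = 0] stays apart, since [r.-1] does not
   follow the pattern there. *)
have tel k : k < n.+1 ->
    sumn [seq F r | r <- iota 1 k] + 2 ^ k * 'C(2 * n - k, n.+1) = 'C(2 * n, n.+1).
  elim: k => [|k IHk] kn; first by rewrite /= mul1n subn0.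
  rewrite -[k.+1]addn1 iotaD map_cat sumn_cat /= addn0 -(IHk _); last by lia.
  rewrite -addnA; congr (_ + _); rewrite /F add1n addn1 /=.
  have {Fr} := Fr k.+1 ltac:(lia).
  have -> : 2 * n - k = (2 * n - k.+1).+1 by lia.
  rewrite binS expnS; move: (size _) => A <-.
  move: ('C(_, _)) (2 ^ k) => B C; nia.
have := tel n (ltnSn n).
have -> : 2 * n - n = n by lia.
rewrite (bin_small (ltnSn n)) muln0 addn0 /= => ->; rewrite /F expn0 muln1.
by have := Fr 0 (leq0n n); rewrite !subn0.
Qed.

Local Open Scope ring_scope.

(** * Increasing sequences *)

(** A down-closed predicate is a threshold, and the threshold is its count. This is how the counts
    stored in a code give back every single comparison. *)
Lemma mem_initial (p : pred nat) (n i : nat) :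
  (forall i j, (i < j < n)%N -> p j -> p i) -> (i < n)%N ->
  p i = (i < count p (iota 0 n))%N.
Proof.
elim: n => // n IHn pP; rewrite ltnS => in_.
have pP' j k : (j < k < n)%N -> p k -> p j by move=> jk; apply: pP; lia.
rewrite -[n.+1]addn1 iotaD count_cat /= add0n addn0.
have cn : (count p (iota 0 n) <= n)%N by rewrite -{2}(size_iota 0 n) count_size.
have [pn|pn] := boolP (p n).
  have -> : count p (iota 0 n) = n.
    rewrite -[RHS](size_iota 0 n); apply/eqP; rewrite -all_count; apply/allP => j.
    by rewrite mem_iota => jn; apply: (pP j n) => //; lia.
  by move: in_; rewrite leq_eqVlt => /orP[/eqP->|in']; rewrite ?pn ?(pP i n) //; lia.
rewrite addn0; move: in_; rewrite leq_eqVlt => /orP[/eqP->|/(IHn pP')//].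
by rewrite (negbTE pn) ltnNge cn.
Qed.

Lemma count_initial (p : pred nat) (n t : nat) :
  (t <= n)%N -> (forall i, (i < n)%N -> p i = (i < t)%N) -> count p (iota 0 n) = t.
Proof.
move=> tn pE; rewrite -(subnKC tn) iotaD count_cat add0n.
rewrite (_ : count p (iota 0 t) = t); last first.
  rewrite -[RHS](size_iota 0 t); apply/eqP; rewrite -all_count.
  by apply/allP => i; rewrite mem_iota => it; rewrite pE; lia.
rewrite (_ : count p _ = 0%N) ?addn0 //; apply/eqP; rewrite -leqn0 leqNgt -has_count.
by apply/hasPn => i; rewrite mem_iota => it; rewrite pE; lia.
Qed.

Definition increasing (R : realFieldType) (n : nat) (y : nat -> R) : Prop :=
  forall i j, (i < j < n)%N -> y i < y j.

Lemma increasing_leq (R : realFieldType) n (y : nat -> R) i j :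
  increasing n y -> (i <= j < n)%N -> y i <= y j.
Proof.
move=> yinc /andP[]; rewrite leq_eqVlt => /orP[/eqP-> //|ij jn].
by apply/ltW/yinc; rewrite ij.
Qed.

Definition count_lt1 (R : realFieldType) n (y : nat -> R) : nat :=
  count (fun k => y k < 1) (iota 0 n).

Lemma count_lt1_le (R : realFieldType) n (y : nat -> R) : (count_lt1 n y <= n)%N.
Proof. by rewrite -{2}(size_iota 0 n) count_size. Qed.

Lemma ltr1_count (R : realFieldType) n (y : nat -> R) k :
  increasing n y -> (k < n)%N -> (y k < 1) = (k < count_lt1 n y)%N.
Proof.
move=> yinc kn; apply: (@mem_initial (fun k => y k < 1)) => // i j ijn; apply: lt_trans.
exact: yinc.
Qed.

(** Entry [j - r] of the full list is the number a_j with [j] counted from 0 in [y]. Letting [i] run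
    over all indices below [n] is harmless for increasing [y], as [y i + 1 < y j] forces [i < j]. *)
Definition steps (R : realFieldType) n r (y : nat -> R) : seq nat :=
  mkseq (fun j => count (fun i => y i + 1 < y (r + j)%N) (iota 0 n)) (n - r).

Lemma steps_lt (R : realFieldType) n r (y : nat -> R) i j :
  increasing n y -> (i < n)%N -> (r <= j < n)%N ->
  (y i + 1 < y j) = (i < nth 0%N (steps n r y) (j - r))%N.
Proof.
move=> yinc in_ jn; rewrite nth_mkseq; last lia.
have -> : (r + (j - r) = j)%N by lia.
apply: (@mem_initial (fun i => y i + 1 < y j)) => // i' j' ij'; apply: lt_trans.
by rewrite ltrD2r yinc.
Qed.

Lemma steps_stairs (R : realFieldType) n r (y : nat -> R) :
  increasing n y -> (r <= n)%N -> steps n r y \in stairs (n - r) 0 r.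
Proof.
move=> yinc rn; rewrite mem_stairs size_mkseq eqxx /=; apply/andP; split.
  have sorted_steps : sorted leq (steps n r y).
    apply: (homo_sorted_in (P := [pred j | j < n - r]%N) (e := ltn)) (iota_ltn_sorted _ _).
      move=> j k; rewrite !inE => jn kn jk; apply: sub_count => i /= /lt_trans; apply.
      by apply: yinc; lia.
    by apply/allP => j; rewrite mem_iota inE; lia.
  by case: (steps _ _ _) sorted_steps.
apply/allP => j; rewrite mem_iota add0n => jn.
(* If the count exceeded [r + j], the index [r + j] would itself be counted, giving
   [y (r + j) + 1 < y (r + j)]. *)
set t := nth _ _ _; rewrite leqNgt; apply/negP => ht.
have := steps_lt (i := (r + j)%N) (j := (r + j)%N) (r := r) yinc.
rewrite addKn -/t ht => /(_ ltac:(lia) ltac:(lia)); lra.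
Qed.

Lemma eq_steps (R : realFieldType) n r (y y' : nat -> R) :
  (forall i j, (i < n)%N -> (r <= j < n)%N -> (y i + 1 < y j) = (y' i + 1 < y' j)) ->
  steps n r y = steps n r y'.
Proof.
move=> yy'; apply: (@eq_from_nth _ 0%N); rewrite !size_mkseq // => j jn.
rewrite !nth_mkseq //; apply: eq_in_count => i; rewrite mem_iota => in_.
by apply: yy'; lia.
Qed.

(* [y] is extended from [r] to [r + k] terms one at a time; with [Y] the shift
   of [y] by one place starting with [c], the new term lies between
   [max (Y (r + k)) (1 + Y (a k))] and [1 + y (a k)]. *)
Lemma extend_steps (R : realFieldType) r (c : R) (y0 : nat -> R) (a : nat -> nat) k :
  increasing r y0 -> (forall i, (i < r)%N -> c < y0 i <= c + 1) ->
  (forall i j, (i <= j < k)%N -> (a i <= a j)%N) ->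
  (forall j, (j < k)%N -> (a j <= r + j)%N) ->
  exists y, [/\ forall i, (i < r)%N -> y i = y0 i, increasing (r + k) y,
    forall i, (i < r + k)%N -> c < y i,
    forall j, (j < k)%N -> c + 1 < y (r + j)%N &
    forall i j, (i < r + k)%N -> (j < k)%N ->
      if (i < a j)%N then y i + 1 < y (r + j)%N else y (r + j)%N < y i + 1].
Proof.
move=> y0inc y0c; elim: k => [|k IHk] amono aub.
  exists y0; split => //; first by rewrite addn0.
  by move=> i; rewrite addn0 => /y0c /andP[].
have {IHk} [||y [y0E yinc cy c1y ay]] := IHk.
- by move=> i j ij; apply: amono; lia.
- by move=> j jk; apply: aub; lia.
pose Y i := if i is i'.+1 then y i' else c.
have Yc i : (i <= r + k)%N -> c <= Y i.
  by case: i => //= i ik; apply/ltW/cy; lia.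
pose L := Num.max (Y (r + k)%N) (1 + Y (a k)).
have ak := aub k (ltnSn k).
have YL : Y (r + k)%N <= L by rewrite le_max lexx.
have YL' : 1 + Y (a k) <= L by rewrite le_max lexx orbT.
(* When [a k = r + k], all earlier terms have to lie below [z - 1] and nothing bounds [z] from
   above; otherwise a midpoint is taken. *)
have [z Lz zU] : exists2 z, L < z & (a k < r + k)%N -> z < y (a k) + 1.
  case: ltnP => [ak'|_]; last by exists (L + 1) => //; lra.
  suff LU : L < y (a k) + 1 by exists ((L + (y (a k) + 1)) / 2) => [|_]; lra.
  rewrite gt_max; apply/andP; split; last first.
    rewrite addrC ltrD2r /Y; case: (a k) ak' => [|i] ir; first exact: cy.
    by apply: yinc; lia.
  (* The last term present is below [y (a k) + 1]: for [k = 0] it is at most [c + 1]; later on,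
     monotonicity of [a] puts the index [a k] outside those counted by the preceding entry. *)
  case: k ay ak ak' cy c1y amono {aub yinc Yc L YL YL'} => [|k] ay ak ak' cy c1y amono.
    rewrite addn0 in ak' cy *.
    case: r ak' y0c y0E cy {ay y0inc ak c1y} => // r ak' y0c y0E cy /=.
    have := y0c r (ltnSn r); rewrite -y0E // => /andP[_]; have := cy _ ak'; lra.
  have := ay (a k.+1) k ak' (ltnSn k); rewrite ltnNge amono ?addnS //=; lia.
have yz i : (i < r + k)%N -> y i < z.
  move=> ik; apply: le_lt_trans Lz; apply: le_trans YL.
  rewrite /Y; case: (r + k)%N ik yinc => // s ik yinc; apply: increasing_leq yinc _; lia.
exists (fun i => if i == (r + k)%N then z else y i); split => [i ir|i j ij|i ik|j jk|i j ik jk].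
- by rewrite ifN ?y0E //; lia.
- rewrite ifN; last lia.
  by case: eqP => [_|/eqP jk]; [apply: yz; lia | apply: yinc; lia].
- case: eqP => [_|/eqP ik']; last by apply: cy; lia.
  have := Yc _ (leqnn (r + k)%N); lra.
- rewrite eqn_add2l; case: eqP => [_|/eqP jk']; last by apply: c1y; lia.
  have := Yc _ ak; lra.
- rewrite eqn_add2l; case: (eqVneq j k) => [->|jk']; last first.
    case: eqP => [->|/eqP ik']; last by apply: ay; lia.
    have jrk : (r + j < r + k)%N by lia.
    rewrite ifN; first by have := yz _ jrk; lra.
    have := aub j jk; lia.
  case: eqP => [->|/eqP ik']; first by rewrite ifN; [lra | lia].
  case: ltnP => [iak|aki]; last first.
    have ak' : (a k < r + k)%N by lia.
    apply: lt_le_trans (zU ak') _; rewrite lerD2r; apply: increasing_leq yinc _; lia.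
  apply: le_lt_trans Lz; apply: le_trans YL'; rewrite addrC lerD2l /Y.
  case: (a k) iak ak => // s iak ak; apply: increasing_leq yinc _; lia.
Qed.

(** The number [c] stands for a term preceding [y]: it is 0 for regions, and for sketches the
    smallest of 1 and the magnitudes. The bound [c + 1 < y j] then reads [1 < y j], respectively the
    gap required by the position of the pointed beta. *)
Lemma realize_steps (R : realFieldType) n r (c : R) (y0 : nat -> R) (a : seq nat) :
  (r <= n)%N -> increasing r y0 -> (forall i, (i < r)%N -> c < y0 i <= c + 1) ->
  a \in stairs (n - r) 0 r ->
  exists y, [/\ forall i, (i < r)%N -> y i = y0 i, increasing n y,
    forall j, (r <= j < n)%N -> c + 1 < y j,
    forall i j, (i < n)%N -> (r <= j < n)%N -> y i + 1 != y j &
    steps n r y = a].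
Proof.
move=> rn y0inc y0c; rewrite mem_stairs => /and3P[/eqP sa pa /allP aub].
have := extend_steps (k := (n - r)%N) (a := nth 0%N a) y0inc y0c.
case => [i j ij|j jk|y [y0E yinc cy c1y ay]].
- have : sorted leq a by case: (a) pa => //= ? ? /andP[].
  by move/(sorted_leq_nth leq_trans leqnn 0%N); apply; rewrite ?inE ?sa; lia.
- by apply: aub; rewrite mem_iota.
move: yinc cy ay; rewrite subnKC // => yinc cy ay.
have ay' i j : (i < n)%N -> (r <= j < n)%N ->
    if (i < nth 0%N a (j - r))%N then y i + 1 < y j else y j < y i + 1.
  by move=> in_ jn; have := ay i (j - r)%N in_; rewrite subnKC; [apply|]; lia.
exists y; split => // [j jn|i j in_ jn|].
- by have := c1y (j - r)%N; rewrite subnKC; [apply|]; lia.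
- by have := ay' i j in_ jn; case: ifP; lra.
apply: (@eq_from_nth _ 0%N); rewrite size_mkseq // => j jn.
rewrite nth_mkseq //; apply: count_initial.
  by have := aub j; rewrite mem_iota => /(_ ltac:(lia)); lia.
by move=> i in_; have := ay i j in_ jn; case: ifP => // _; lra.
Qed.

(** * Sums of two terms below 1 *)

Fixpoint sum_bits (R : realFieldType) (y : nat -> R) (lo m : nat) : seq bool :=
  if m is m'.+1 then
    let b := 1 < y lo + y (lo + m)%N in b :: sum_bits y (if b then lo else lo.+1) m'
  else [::].

Lemma size_sum_bits (R : realFieldType) (y : nat -> R) lo m : size (sum_bits y lo m) = m.
Proof. by elim: m lo => //= m IHm lo; rewrite IHm. Qed.

Lemma eq_sum_bits (R : realFieldType) (y y' : nat -> R) lo lo' m :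
  (forall i j, (i < j <= m)%N ->
    (1 < y (lo + i)%N + y (lo + j)%N) = (1 < y' (lo' + i)%N + y' (lo' + j)%N)) ->
  sum_bits y lo m = sum_bits y' lo' m.
Proof.
elim: m lo lo' => //= m IHm lo lo' yy'.
have := yy' 0%N m.+1; rewrite !addn0 => <- //; last by lia.
congr cons.
case: ifP => _; apply: IHm => i j ij; first by apply: yy'; lia.
by rewrite !addSnnS; apply: yy'; lia.
Qed.

(** If the sum of the two ends of the interval exceeds 1, so does every sum with the upper end,
    which is then removed; otherwise every sum with the lower end is below 1, and that end is
    removed. Equal bits therefore mean equal comparisons at each stage. *)
Lemma sum_bitsP (R : realFieldType) (y y' : nat -> R) n lo m :
  increasing n y -> increasing n y' -> (lo + m < n)%N ->
  (forall i j, (i < j < n)%N -> y i + y j != 1) ->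
  (forall i j, (i < j < n)%N -> y' i + y' j != 1) ->
  sum_bits y lo m = sum_bits y' lo m ->
  forall i j, (lo <= i < j)%N -> (j <= lo + m)%N -> (1 < y i + y j) = (1 < y' i + y' j).
Proof.
move=> yinc yinc' lm ny ny'; elim: m lo lm => [|m IHm] lo lm /=.
  by move=> _ i j; lia.
case=> bE sE i j ij jm.
case: (ltrP 1 (y lo + y (lo + m.+1)%N)) bE sE => b /esym b' sE.
  case: (eqVneq j (lo + m.+1)%N) => [jE|jm'].
    have := increasing_leq (i := lo) (j := i) yinc; have := increasing_leq (i := lo) (j := i) yinc'.
    rewrite jE in ij * => /(_ ltac:(lia)) h' /(_ ltac:(lia)) h.
    by apply/idP/idP; lra.
  by rewrite b' in sE; apply: IHm sE _ _ _ _; lia.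
case: (eqVneq i lo) => [iE|il].
  have := increasing_leq (i := j) (j := (lo + m.+1)%N) yinc.
  have := increasing_leq (i := j) (j := (lo + m.+1)%N) yinc'.
  rewrite iE in ij * => /(_ ltac:(lia)) h' /(_ ltac:(lia)) h.
  by apply/idP/idP; lra.
rewrite b' in sE; apply: IHm sE _ _ _ _; lia.
Qed.

(** Each false bit moves the lower end up, so this is the only index left at the end. By [core_sum]
    its term is the one of the interval nearest to 1/2. *)
Definition core (lo : nat) (v : seq bool) : nat := (lo + count negb v)%N.

Lemma core_bounds (R : realFieldType) (y : nat -> R) lo m :
  (lo <= core lo (sum_bits y lo m) <= lo + m)%N.
Proof.
by rewrite /core leq_addr leq_add2l -[leqRHS](size_sum_bits y lo) count_size.
Qed.

Lemma core_sum (R : realFieldType) (y : nat -> R) n lo m i :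
  increasing n y -> (lo + m < n)%N -> (forall i j, (i < j < n)%N -> y i + y j != 1) ->
  (lo <= i <= lo + m)%N ->
  let k := core lo (sum_bits y lo m) in
  ((i < k)%N -> y i + y k < 1) /\ ((k < i)%N -> 1 < y i + y k).
Proof.
move=> yinc + ny; elim: m lo => [|m IHm] lo lm im k.
  by rewrite /k /core /=; lia.
have := core_bounds y lo m.+1; rewrite -/k.
have := ny lo (lo + m.+1)%N ltac:(lia); rewrite /k /=.
case: ltrP => b neq.
  rewrite /core /= add0n -/(core lo _); set k' := core _ _ => kb.
  case: (eqVneq i (lo + m.+1)%N) => [iE|im']; last by apply: IHm; lia.
  have := core_bounds y lo m; rewrite -/k' => kb'.
  have := increasing_leq (i := lo) (j := k') yinc ltac:(lia).
  rewrite iE; split; [lia | lra].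
rewrite /core /= -/(core _ _) addnA addn1; set k' := (lo.+1 + _)%N => kb.
case: (eqVneq i lo) => [iE|im']; last by apply: (IHm lo.+1); lia.
have := increasing_leq (i := k') (j := (lo + m.+1)%N) yinc ltac:(lia).
rewrite iE; split; last by lia.
by lra.
Qed.

(** Bits go from the outermost pair inwards, so in the induction a bit adds a new extreme term: a
    maximum if it is true, a minimum if it is false. The core term survives unchanged from the base
    case, where it is 3/4. *)
Lemma realize_sum_bits (R : realFieldType) (v : seq bool) :
  exists y : nat -> R, let m := size v in
  [/\ increasing m.+1 y, forall i, (i <= m)%N -> 0 < y i < 1 /\ y i != 1 / 2,
      forall i j, (i < j <= m)%N -> y i + y j != 1,
      1 / 2 < y (core 0 v) & sum_bits y 0 m = v].
Proof.
elim: v => [|b v [y [yinc y01 ny yk yv]]].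
  exists (fun=> 3 / 4); split => //= [i j|i _|i j|]; [lia | | lia | lra].
  by split; [lra | rewrite neq_lt; lra].
set m := size v in yinc y01 ny yv.
have kb := core_bounds y 0 m; rewrite yv in kb.
have ym : 1 / 2 < y m by apply: lt_le_trans yk _; apply: increasing_leq yinc _; lia.
have y0 := (y01 0%N (leq0n _)).1; have y1 := (y01 m (leqnn _)).1.
have y0m := increasing_leq (i := 0%N) (j := m) yinc ltac:(lia).
case: b.
  (* Above [1 - y 0], so that even the sum with the smallest term exceeds 1. *)
  pose z := (1 + Num.max (y m) (1 - y 0%N)) / 2.
  have [z1 zm z0] : [/\ z < 1, y m < z & 1 < y 0%N + z].
    by rewrite /z; case: (ltrP (y m) (1 - y 0%N)) => h; split; lra.
  exists (fun i => if i == m.+1 then z else y i); split => /= [i j ij|i im|i j ij||].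
  - rewrite ifN; last by clear -ij; lia.
    case: eqP => [_|/eqP jm]; last by apply: yinc; clear -ij jm; lia.
    apply: le_lt_trans zm; apply: increasing_leq yinc _; clear -ij; lia.
  - case: eqP => [_|/eqP im']; last by apply: y01; clear -im im'; lia.
    by split; [lra | rewrite neq_lt; lra].
  - rewrite ifN; last by clear -ij; lia.
    case: (eqVneq j m.+1) => [_|jm]; last by apply: ny; clear -ij jm; lia.
    have := increasing_leq (i := 0%N) (j := i) yinc ltac:(clear -ij; lia); rewrite neq_lt; lra.
  - rewrite /core /= -/(core 0 v) ifN //; clear -kb; lia.
  - rewrite add0n eqxx /= z0 /=; congr cons; rewrite -[RHS]yv; apply: eq_sum_bits => i j ij.
    by rewrite !ifN //; clear -ij; lia.
(* Below [1 - y m], so that even the sum with the largest term stays under 1. *)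
pose z := (Num.min (y 0%N) (1 - y m)) / 2.
have [z1 zm z0] : [/\ 0 < z, z < y 0%N & z + y m < 1].
  by rewrite /z; case: (ltrP (y 0%N) (1 - y m)) => h; split; lra.
exists (fun i => if i is i'.+1 then y i' else z); split => /= [i j ij|i im|i j ij||].
- case: i j ij => [|i] [|j] //= ij; last by apply: yinc; clear -ij; lia.
  apply: lt_le_trans zm _; apply: increasing_leq yinc _; clear -ij; lia.
- case: i im => [_|i im]; last exact: y01.
  by split; [lra | rewrite neq_lt; lra].
- case: i j ij => [|i] [|j] //= ij; last by apply: ny; clear -ij; lia.
  have := increasing_leq (i := j) (j := m) yinc ltac:(clear -ij; lia); rewrite neq_lt; lra.
- by rewrite /core /= add0n.
- rewrite (negbTE (_ : ~~ (1 < z + y m))); last by rewrite -leNgt ltW.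
  by rewrite /=; congr cons; rewrite -[RHS]yv; apply: eq_sum_bits => i j ij.
Qed.

(** * Codes of regions *)

Definition generic_seq (R : realFieldType) n (y : nat -> R) : Prop :=
  [/\ increasing n y, forall k, (k < n)%N -> 0 < y k /\ y k != 1,
      forall i j, (i < j < n)%N -> y i + 1 != y j &
      forall i j, (i < j < n)%N -> y i + y j != 1].

Definition same_region (R : realFieldType) n (y y' : nat -> R) : Prop :=
  [/\ forall k, (k < n)%N -> (y k < 1) = (y' k < 1),
      forall i j, (i < j < n)%N -> (y i + 1 < y j) = (y' i + 1 < y' j) &
      forall i j, (i < j < n)%N -> (1 < y i + y j) = (1 < y' i + y' j)].

Definition region_code (R : realFieldType) n (y : nat -> R) : nat * (seq nat * seq bool) :=
  let r := count_lt1 n y in (r, (steps n r y, sum_bits y 0 r.-1)).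

Lemma gt1_count (R : realFieldType) n (y : nat -> R) k :
  generic_seq n y -> (count_lt1 n y <= k < n)%N -> 1 < y k.
Proof.
move=> [yinc ypos _ _] kn; have [_] := ypos k ltac:(lia).
have : (y k < 1) = false by rewrite (ltr1_count yinc); lia.
by rewrite neq_lt; lra.
Qed.

Lemma sum_gt1 (R : realFieldType) n (y : nat -> R) i j :
  generic_seq n y -> (i < j < n)%N -> (count_lt1 n y <= j)%N -> 1 < y i + y j.
Proof.
move=> gy ij rj; have [_ ypos _ _] := gy.
have [yi _] := ypos i ltac:(lia); have := gt1_count (k := j) gy ltac:(lia); lra.
Qed.

Lemma diff_lt1 (R : realFieldType) n (y : nat -> R) i j :
  generic_seq n y -> (i < j < count_lt1 n y)%N -> (y i + 1 < y j) = false.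
Proof.
move=> [yinc ypos _ _] ij; have rn := count_lt1_le n y.
have [yi _] := ypos i ltac:(lia).
have : y j < 1 by rewrite (ltr1_count yinc); lia.
by move=> yj; apply/negbTE; lra.
Qed.

Lemma count_lt1_same (R : realFieldType) n (y y' : nat -> R) :
  (forall k, (k < n)%N -> (y k < 1) = (y' k < 1)) -> count_lt1 n y = count_lt1 n y'.
Proof. by move=> yy'; apply: eq_in_count => k; rewrite mem_iota; apply: yy'. Qed.

Lemma sum_bits_same (R : realFieldType) n (y y' : nat -> R) r : (r <= n)%N ->
  (forall i j, (i < j < n)%N -> (1 < y i + y j) = (1 < y' i + y' j)) ->
  sum_bits y 0 r.-1 = sum_bits y' 0 r.-1.
Proof. by move=> rn yy'; apply: eq_sum_bits => i j ij; apply: yy'; lia. Qed.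

(** A sum involving a term above 1 exceeds 1 in any case, so the bits of the first [r] terms
    suffice. *)
Lemma sums_eq_of_bits (R : realFieldType) n (y y' : nat -> R) :
  generic_seq n y -> generic_seq n y' -> count_lt1 n y = count_lt1 n y' ->
  sum_bits y 0 (count_lt1 n y).-1 = sum_bits y' 0 (count_lt1 n y').-1 ->
  forall i j, (i < j < n)%N -> (1 < y i + y j) = (1 < y' i + y' j).
Proof.
move=> gy gy' rE bE i j ij; case: (ltnP j (count_lt1 n y)) => jr; last first.
  by rewrite !(sum_gt1 _ ij) -?rE.
have rn := count_lt1_le n y; rewrite -rE in bE.
case: gy gy' => [yinc _ _ ny] [yinc' _ _ ny'].
by apply: (sum_bitsP yinc yinc' _ ny ny' bE); lia.
Qed.

Lemma region_codeP (R : realFieldType) n (y y' : nat -> R) :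
  generic_seq n y -> generic_seq n y' ->
  same_region n y y' <-> region_code n y = region_code n y'.
Proof.
move=> gy gy'; have [yinc _ _ _] := gy; have [yinc' _ _ _] := gy'.
have rn := count_lt1_le n y.
split=> [[lt1 step sum]|[rE sE bE]].
  have rE := count_lt1_same lt1; rewrite /region_code -rE; congr (_, (_, _)).
    apply: eq_steps => i j in_ jn; case: (ltnP i j) => ij; first by apply: step; lia.
    (* For [j <= i] both comparisons are false. *)
    have := increasing_leq (i := j) (j := i) yinc ltac:(lia).
    have := increasing_leq (i := j) (j := i) yinc' ltac:(lia).
    by move=> h h'; apply/idP/idP; lra.
  exact: sum_bits_same sum.
split; last exact: sums_eq_of_bits.
  by move=> k kn; rewrite !(@ltr1_count _ n) // rE.
move=> i j ij; case: (ltnP j (count_lt1 n y)) => jr.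
  by rewrite !(@diff_lt1 _ n) -?rE //; lia.
by rewrite !(@steps_lt _ n (count_lt1 n y)) ?{2}rE ?sE -?rE //; lia.
Qed.

Lemma region_code_mem (R : realFieldType) n (y : nat -> R) :
  increasing n y -> region_code n y \in codes n.
Proof.
move=> yinc; have rn := count_lt1_le n y.
by rewrite mem_codes rn steps_stairs //= size_sum_bits.
Qed.

Lemma realize_small (R : realFieldType) (r : nat) (v : seq bool) : size v = r.-1 ->
  exists y : nat -> R,
  [/\ increasing r y, forall i, (i < r)%N -> 0 < y i < 1 /\ y i != 1 / 2,
      forall i j, (i < j < r)%N -> y i + y j != 1,
      (0 < r)%N -> 1 / 2 < y (core 0 v) & sum_bits y 0 r.-1 = v].
Proof.
case: r => [/size0nil ->|r /= <-].
  by exists (fun=> 0); split => // i j; lia.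
have [y [yinc y01 ny yk yv]] := realize_sum_bits R v.
by exists y; split.
Qed.

Lemma region_code_surj (R : realFieldType) n c : c \in codes n ->
  exists2 y : nat -> R, generic_seq n y & region_code n y = c.
Proof.
case: c => r [a v]; rewrite mem_codes => /and3P[rn ast /eqP sv].
have [y0 [y0inc y01 ny0 _ y0v]] := realize_small R sv.
have [|y [yE yinc cy ny ya]] := realize_steps (c := 0) rn y0inc _ ast.
  by move=> i /y01[+ _]; lra.
have rE : count_lt1 n y = r.
  apply: count_initial => // k kn; case: ltnP => kr; first by rewrite yE //; have := y01 k kr; lra.
  by apply/negbTE; have := cy k ltac:(lia); lra.
exists y; last first.
  rewrite /region_code rE ya -y0v; congr (_, (_, _)); apply: eq_sum_bits => i j ij.
  by rewrite !yE; lia.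
have ypos k : (k < n)%N -> 0 < y k /\ y k != 1.
  move=> kn; case: (ltnP k r) => kr; first by rewrite yE // neq_lt; have := y01 k kr; lra.
  by rewrite neq_lt; have := cy k ltac:(lia); lra.
split => // i j ij; case: (ltnP j r) => jr.
- by rewrite neq_lt !yE; [have := y01 j jr; have := y01 i ltac:(lia); lra | lia..].
- by apply: ny; lia.
- by rewrite !yE; [apply: ny0; lia | lia..].
- by rewrite neq_lt; have := cy j ltac:(lia); have := ypos i ltac:(lia); lra.
Qed.

(** * Codes of type B sketches *)

Definition sketch_seq (R : realFieldType) n (y : nat -> R) : Prop :=
  [/\ generic_seq n y, forall k, (k < n)%N -> y k != 1 / 2 /\ y k != 2,
      forall k, (k < n)%N -> 1 < y k -> 1 + Num.min (y 0%N) 1 < y k &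
      (forall k, (k < n)%N -> 1 < y k) \/
      exists2 i, (i < n)%N & 1 / 2 < y i < 1 /\ forall j, (j < n)%N ->
        if y j < 1 / 2 then y i + y j < 1 else y i <= y j].

Definition same_sketch (R : realFieldType) n (y y' : nat -> R) : Prop :=
  [/\ same_region n y y', forall k, (k < n)%N -> (y k < 1 / 2) = (y' k < 1 / 2) &
      forall k, (k < n)%N -> (y k < 2) = (y' k < 2)].

(* Together with the smallest of [1, y 0, ..., y (n - 1)], these are the terms of
   the sorted list of [1, y 0, ..., y (n - 1)], where [r] is the rank of [1]. *)
Definition insert1 (R : realFieldType) (r : nat) (y : nat -> R) (k : nat) : R :=
  if (k.+1 < r)%N then y k.+1 else if k.+1 == r then 1 else y k.

(** Inserting 1 makes [steps] record the comparisons of the terms with 2, which sketches see and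
    regions do not. Dropping the smallest term loses nothing: by the gap condition of [sketch_seq],
    every [y j] above 1 exceeds that term plus 1. *)
Definition sketch_code (R : realFieldType) n (y : nat -> R) : nat * (seq nat * seq bool) :=
  let r := count_lt1 n y in (r, (steps n r (insert1 r y), sum_bits y 0 r.-1)).

Lemma insert1_increasing (R : realFieldType) n (y : nat -> R) : generic_seq n y ->
  increasing n (insert1 (count_lt1 n y) y).
Proof.
move=> gy; have [yinc ypos _ _] := gy; move=> i j ij; rewrite /insert1.
have lt1 k : (k < n)%N -> (y k < 1) = (k < count_lt1 n y)%N by move=> kn; apply: ltr1_count.
have rn := count_lt1_le n y.
case: ltnP => ir; case: ltnP => jr; first by apply: yinc; lia.
- have yi := lt1 i.+1 ltac:(lia); rewrite ir in yi.
  case: eqP => jE //; apply: yinc; lia.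
- lia.
case: eqP => iE; first by rewrite ifN; [apply: (gt1_count gy)|]; lia.
by rewrite ifN; [apply: yinc|]; lia.
Qed.

(** The witness [i] in the last condition of [sketch_seq] exceeds 1/2. Were the core below 1/2, it
    would come before [i], and their sum would be above 1 by [core_sum] but below 1 by the choice of
    [i]. *)
Lemma sketch_core (R : realFieldType) n (y : nat -> R) :
  sketch_seq n y -> let r := count_lt1 n y in
  (0 < r)%N -> 1 / 2 < y (core 0 (sum_bits y 0 r.-1)).
Proof.
move=> [[yinc ypos _ ny] yhalf _ yc] r r0.
have rn : (r <= n)%N := count_lt1_le n y.
case: yc => [y1|[i in_ [yi yj]]].
  have := y1 0%N ltac:(lia); have := ltr1_count (k := 0%N) yinc ltac:(lia).
  by rewrite -/r r0; lra.
have := core_bounds y 0 r.-1; set k := core _ _ => kb.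
have ir : (i < r)%N by rewrite -(ltr1_count yinc) //; lra.
have [] := core_sum (n := n) (lo := 0%N) (m := r.-1) (i := i) yinc ltac:(lia) ny ltac:(lia).
rewrite -/k => ik ki.
have [+ _] := yhalf k ltac:(lia); have := yj k ltac:(lia).
rewrite neq_lt; case: ifP => // ykhalf.
case: (ltngtP i k) => ikE; last by rewrite -ikE; lra.
  have := yinc i k ltac:(lia); lra.
by have := ki ikE; lra.
Qed.

(** The core term lies above 1/2, and a term before it has sum below 1 with it, hence lies below
    1/2. Thus the code also determines the comparisons with 1/2. *)
Lemma ltr_half_core (R : realFieldType) n (y : nat -> R) k :
  sketch_seq n y -> let r := count_lt1 n y in (k < n)%N ->
  (y k < 1 / 2) = ((0 < r) && (k < core 0 (sum_bits y 0 r.-1)))%N.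
Proof.
move=> sy r kn; have [gy yhalf _ _] := sy; have [yinc ypos _ ny] := gy.
have rn : (r <= n)%N := count_lt1_le n y.
case: (posnP r) => [r0|r0] /=.
  by apply/negbTE; have := gt1_count (k := k) gy; rewrite -/r r0 kn => /(_ isT); lra.
have := core_bounds y 0 r.-1; have := sketch_core sy r0; set c := core _ _ => yc cb.
case: (ltnP k c) => kc.
  have [] := core_sum (n := n) (lo := 0%N) (m := r.-1) (i := k) yinc ltac:(lia) ny ltac:(lia).
  by rewrite -/c => /(_ kc) h _; have := yinc k c ltac:(lia); lra.
by apply/negbTE; have := increasing_leq (i := c) (j := k) yinc ltac:(lia); lra.
Qed.

Lemma insert1_ge (R : realFieldType) r (y : nat -> R) k : (r <= k)%N -> insert1 r y k = y k.
Proof. by move=> rk; rewrite /insert1 !ifN //; lia. Qed.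

Lemma sketch_codeP (R : realFieldType) n (y y' : nat -> R) :
  sketch_seq n y -> sketch_seq n y' ->
  same_sketch n y y' <-> sketch_code n y = sketch_code n y'.
Proof.
move=> sy sy'; have [gy _ y0c _] := sy; have [gy' _ y0c' _] := sy'.
have yinc : increasing n y by case: gy.
have yinc' : increasing n y' by case: gy'.
have rn := count_lt1_le n y.
have winc := insert1_increasing gy; have winc' := insert1_increasing gy'.
split=> [[[lt1 step sum] _ lt2]|[rE sE bE]].
  have rE := count_lt1_same lt1; rewrite /sketch_code -rE; congr (_, (_, _)).
    apply: eq_steps => i j in_ jn; rewrite !(@insert1_ge _ _ _ j); [|lia..].
    case: (ltnP i j) => ij; last first.
      have := increasing_leq (i := j) (j := i) winc ltac:(lia).
      have := increasing_leq (i := j) (j := i) winc' ltac:(lia).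
      rewrite -rE !(@insert1_ge _ _ _ j); [|lia..].
      by move=> h h'; apply/idP/idP; lra.
    rewrite /insert1; case: ltnP => ir; first by apply: step; lia.
    (* The entry of index [r - 1] is 1, so the comparison is that of [y j] with 2, given by
       [lt2]. *)
    case: eqP => ir'; last by apply: step; lia.
    have [[_ _ _ _] yn _ _] := sy; have [[_ _ _ _] yn' _ _] := sy'.
    have [_ +] := yn j ltac:(lia); have [_ +] := yn' j ltac:(lia).
    have := lt2 j ltac:(lia); rewrite !neq_lt => h h1 h2.
    by apply/idP/idP; lra.
  exact: sum_bits_same sum.
have lt1 k : (k < n)%N -> (y k < 1) = (y' k < 1).
  by move=> kn; rewrite !(@ltr1_count _ n) // rE.
have big k : (count_lt1 n y <= k < n)%N -> 1 < y k /\ 1 < y' k.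
  by move=> kn; split; [apply: (gt1_count gy) | apply: (gt1_count gy'); rewrite -rE].
have wstep i j : (i < n)%N -> (count_lt1 n y <= j < n)%N ->
    (insert1 (count_lt1 n y) y i + 1 < y j) = (insert1 (count_lt1 n y) y' i + 1 < y' j).
  move=> in_ jn; have := steps_lt winc in_ jn; rewrite (@insert1_ge _ _ _ j); last lia.
  move=> ->; rewrite sE.
  rewrite -rE in winc' *; have := steps_lt winc' in_ jn.
  by rewrite (@insert1_ge _ _ _ j) => [<-|]; lia.
have small : (0 < count_lt1 n y)%N -> y 0%N < 1 /\ y' 0%N < 1.
  by move=> r0; rewrite (ltr1_count yinc) ?(ltr1_count yinc') -?rE; lia.
split; last first.
- move=> k kn; case: (ltnP k (count_lt1 n y)) => kr.
    have := ltr1_count yinc kn; have := lt1 k kn; rewrite kr => h h'.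
    by apply/idP/idP; lra.
  have [yk yk'] := big k ltac:(lia).
  have := y0c k kn yk; have := y0c' k kn yk'.
  (* If no term is below 1, the gap condition puts every term above 2; otherwise the entry 1 of
     [insert1] decides. *)
  case: (posnP (count_lt1 n y)) => [r0|r0].
    have [y00 y00'] := big 0%N ltac:(lia).
    by rewrite !min_r ?ltW // => h h'; apply/idP/idP; lra.
  have := wstep (count_lt1 n y).-1 k ltac:(lia) ltac:(lia).
  rewrite /insert1 prednK // ltnn eqxx => h _ _.
  have [_ yn _ _] := sy; have [_ yn' _ _] := sy'.
  have [_ +] := yn k ltac:(lia); have [_ +] := yn' k ltac:(lia).
  by rewrite !neq_lt => h1 h2; apply/idP/idP; lra.
- by move=> k kn; rewrite !(@ltr_half_core _ n) // -?rE bE -?rE.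
split => //; last exact: sums_eq_of_bits.
move=> i j ij; case: (ltnP j (count_lt1 n y)) => jr.
  by rewrite !(@diff_lt1 _ n) -?rE //; lia.
case: (ltnP i (count_lt1 n y)) => ir; last first.
  by have := wstep i j ltac:(lia) ltac:(lia); rewrite !insert1_ge.
(* For [i = 0] the term is absent from the list, and the gap condition makes both inequalities
   true. *)
case: i ij ir => [|i] ij ir; last first.
  by have := wstep i j ltac:(lia) ltac:(lia); rewrite /insert1 ir.
have [yj yj'] := big j ltac:(lia); have [y0 y0'] := small ir.
have := y0c j ltac:(lia) yj; have := y0c' j ltac:(lia) yj'.
rewrite !min_l ?ltW // => h h'; apply/idP/idP; lra.
Qed.

Lemma sketch_code_mem (R : realFieldType) n (y : nat -> R) :
  generic_seq n y -> sketch_code n y \in codes n.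
Proof.
move=> gy; have rn := count_lt1_le n y.
by rewrite mem_codes rn steps_stairs ?size_sum_bits //=; apply: insert1_increasing.
Qed.

Lemma sketch_code_surj (R : realFieldType) n c : c \in codes n ->
  exists2 y : nat -> R, sketch_seq n y & sketch_code n y = c.
Proof.
case: c => r [a v]; rewrite mem_codes => /and3P[rn ast /eqP sv].
have [y0 [y0inc y01 ny0 y0c y0v]] := realize_small R sv.
(* The term to be dropped; [w] then starts the list without it, with the other small terms followed
   by 1. *)
pose c := if r is 0 then 1 else y0 0%N.
have c0 : 0 < c <= 1.
  by rewrite /c; case: (r) y01 => [|r'] y01; [lra | have := y01 0%N (ltn0Sn _); lra].
pose w k := if (k.+1 < r)%N then y0 k.+1 else 1.
have winc : increasing r w.
  move=> i j ij; rewrite /w; case: ltnP => ir; last lia.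
  by case: ltnP => jr; [apply: y0inc; lia | have := y01 i.+1 ir; lra].
have wc i : (i < r)%N -> c < w i <= c + 1.
  move=> ir; rewrite /w; case: ltnP => ir'; last first.
    by rewrite /c; case: (r) ir y01 => // r' ir y01; have := y01 0%N (ltn0Sn _); lra.
  have := y01 _ ir'; have := y01 0%N ltac:(lia); have := y0inc 0%N i.+1 ltac:(lia).
  by rewrite /c; case: (r) ir => // r' _; lra.
have [y' [yE yinc cy ny ya]] := realize_steps rn winc wc ast.
(* This undoes [insert1]: the dropped term comes back and 1 is removed, so that from [r] on the
   indices agree. *)
pose y k := if (k < r)%N then y0 k else y' k.
have ysmall k : (k < r)%N -> y k = y0 k by rewrite /y => ->.
have ybig k : (r <= k)%N -> y k = y' k by rewrite /y ltnNge => ->.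
have cbig k : (r <= k < n)%N -> c + 1 < y k by move=> kn; rewrite ybig; [apply: cy|]; lia.
have rE : count_lt1 n y = r.
  apply: count_initial => // k kn; case: ltnP => kr.
    by rewrite ysmall //; have := y01 k kr; lra.
  by apply/negbTE; have := cbig k ltac:(lia); lra.
have iE k : (k < n)%N -> insert1 r y k = y' k.
  move=> kn; rewrite /insert1; case: ltnP => kr.
    by rewrite ysmall // yE ?/w ?kr //; lia.
  case: eqP => [kr'|kr']; first by rewrite yE /w ?ifN //; lia.
  by rewrite ybig //; lia.
exists y; last first.
  rewrite /sketch_code rE -ya -y0v; congr (_, (_, _)).
    by apply: eq_steps => i j in_ jn; rewrite !iE //; lia.
  by apply: eq_sum_bits => i j ij; rewrite !ysmall; lia.
have yincr : increasing n y.
  move=> i j ij; case: (ltnP j r) => jr; first by rewrite !ysmall; [apply: y0inc|..]; lia.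
  case: (ltnP i r) => ir; last by rewrite !ybig; [apply: yinc|..]; lia.
  have := cbig j ltac:(lia); rewrite (ysmall i ir); have := y01 i ir; lra.
have ypos k : (k < n)%N -> 0 < y k /\ y k != 1.
  move=> kn; case: (ltnP k r) => kr; first by rewrite ysmall // neq_lt; have := y01 k kr; lra.
  by rewrite neq_lt; have := cbig k ltac:(lia); lra.
have cE : (0 < r)%N -> y 0%N = c by move=> r0; rewrite ysmall // /c; case: (r) r0.
split.
- split => // i j ij; case: (ltnP j r) => jr.
  + by rewrite neq_lt !ysmall; [have := y01 j jr; have := y01 i ltac:(lia); lra | lia..].
  + case: i ij => [|i] ij.
      have := cbig j ltac:(lia); case: (posnP r) => r0; last by rewrite cE // neq_lt; lra.
      by rewrite !ybig ?r0 // => _; apply: ny; lia.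
    case: (ltnP i.+1 r) => ir; last by rewrite !ybig; [apply: ny|..]; lia.
    have <- : insert1 r y i = y i.+1 by rewrite /insert1 ir.
    by rewrite iE ?(ybig j jr); [apply: ny|]; lia.
  + by rewrite !ysmall; [apply: ny0; lia | lia..].
  + by rewrite neq_lt; have := cbig j ltac:(lia); have := ypos i ltac:(lia); lra.
- move=> k kn; case: (ltnP k r) => kr.
    by rewrite ysmall //; have [h h'] := y01 k kr; split => //; rewrite neq_lt; lra.
  have ck := cbig k ltac:(lia); split; first by rewrite neq_lt; lra.
  case: (posnP r) => r0; first by move: ck; rewrite /c r0 neq_lt; lra.
  have := ny r.-1 k ltac:(lia) ltac:(lia); rewrite yE ?/w ?ifN ?ybig //; try lia.
  by rewrite !neq_lt; lra.
- move=> k kn; case: (ltnP k r) => kr.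
    by rewrite ysmall //; have := y01 k kr; lra.
  have := cbig k ltac:(lia); case: (posnP r) => r0.
    have := cbig 0%N ltac:(lia); rewrite /c r0 => h h' _; rewrite min_r; lra.
  by rewrite cE // min_l; lra.
case: (posnP r) => r0.
  by left=> k kn; have := cbig k ltac:(lia); lra.
right; have := core_bounds y0 0 r.-1; rewrite y0v; set k := core 0 v => kb.
have kr : (k < r)%N by lia.
(* The core is the witness: its magnitude gives the last letter of the first half, a beta. *)
exists k; first lia.
have yk := y0c r0; rewrite -/k in yk.
rewrite ysmall //; split; first by have := y01 k kr; lra.
move=> j jn; case: (ltnP j r) => jr; last first.
  have := cbig j ltac:(lia); have := y01 k kr.
  by case: ifP; lra.
rewrite ysmall //.
have [] := core_sum (n := r) (lo := 0%N) (m := r.-1) (i := j) y0inc ltac:(lia) ny0 ltac:(lia).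
rewrite y0v -/k => jk kj.
case: (ltngtP j k) => h.
- have := jk h; have := y0inc j k ltac:(lia).
  have [_] := y01 j jr; rewrite neq_lt; case: ifP; lra.
- by have := y0inc k j ltac:(lia); case: ifP; lra.
- by rewrite h; case: ifP; lra.
Qed.

(** * Points and signed permutations *)

(** Zero is excluded, so that [agree p p] says [p != 0]: one relation serves both for genericity of
    a point and for equality of two sign patterns. *)
Definition agree (R : realFieldType) (p q : R) : Prop :=
  p < 0 /\ q < 0 \/ 0 < p /\ 0 < q.

(* In these coordinates the arrangement is the type B Catalan arrangement. *)
Definition centred (R : realFieldType) n (x : 'rV[R]_n) (i : 'I_n) : R := x 0 i + 1 / 2.

Definition mag (R : realFieldType) n (x : 'rV[R]_n) (i : 'I_n) : R := `|centred x i|.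

Definition signs (R : realFieldType) n (x : 'rV[R]_n) : {ffun 'I_n -> bool} :=
  [ffun i => 0 < centred x i].

Definition mag_order (R : realFieldType) n (x : 'rV[R]_n) : seq 'I_n :=
  sort (fun i j => mag x i <= mag x j) (enum 'I_n).

Definition mags (R : realFieldType) n (x : 'rV[R]_n) (k : nat) : R :=
  nth 0 [seq mag x i | i <- mag_order x] k.

Lemma perm_mag_order (R : realFieldType) n (x : 'rV[R]_n) :
  perm_eq (mag_order x) (enum 'I_n).
Proof. by rewrite perm_sort. Qed.

Lemma mem_mag_order (R : realFieldType) n (x : 'rV[R]_n) i : i \in mag_order x.
Proof. by rewrite mem_sort mem_enum. Qed.

Lemma size_mag_order (R : realFieldType) n (x : 'rV[R]_n) : size (mag_order x) = n.
Proof. by rewrite size_sort size_enum_ord. Qed.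

Lemma index_mag_order_lt (R : realFieldType) n (x : 'rV[R]_n) i :
  (index i (mag_order x) < n)%N.
Proof. by rewrite -[X in (_ < X)%N](size_mag_order x) index_mem mem_mag_order. Qed.

Lemma mags_index (R : realFieldType) n (x : 'rV[R]_n) i :
  mags x (index i (mag_order x)) = mag x i.
Proof.
rewrite /mags (nth_map i) ?nth_index ?mem_mag_order //.
by rewrite index_mem mem_mag_order.
Qed.

Lemma index_mag_order_inj (R : realFieldType) n (x : 'rV[R]_n) i j :
  index i (mag_order x) = index j (mag_order x) -> i = j.
Proof. exact: (index_inj i (mem_mag_order x i) (mem_mag_order x j)). Qed.

Lemma index_mag_order_surj (R : realFieldType) n (x : 'rV[R]_n) k : (k < n)%N ->
  exists i, k = index i (mag_order x).
Proof.
move=> kn; exists (nth (Ordinal kn) (mag_order x) k).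
by rewrite index_uniq ?size_mag_order // sort_uniq enum_uniq.
Qed.

Definition distinct (R : realFieldType) n (x : 'rV[R]_n) : Prop :=
  (forall i, centred x i != 0) /\ injective (mag x).

Lemma mags_increasing (R : realFieldType) n (x : 'rV[R]_n) :
  distinct x -> increasing n (mags x).
Proof.
move=> [_ xinj] i j /andP[ij jn].
have [i' iE] := index_mag_order_surj x (ltn_trans ij jn).
have [j' jE] := index_mag_order_surj x jn.
rewrite iE jE !mags_index lt_neqAle; apply/andP; split.
  by apply/eqP => /xinj ij'; move: ij; rewrite iE jE ij' ltnn.
have := sort_sorted (leT := fun i j => mag x i <= mag x j).
move=> /(_ (fun _ _ => le_total _ _) (enum 'I_n)) => srt.
have tr : transitive (fun i j => mag x i <= mag x j) by move=> a b c; apply: le_trans.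
have := sorted_ltn_nth tr i' srt; move=> /(_ i j).
rewrite !inE -/(mag_order x) size_mag_order => /(_ (ltn_trans ij jn) jn ij).
by rewrite iE jE !nth_index ?mem_mag_order.
Qed.

(** The pairs are ordered, so differences are also compared with -1. All other comparisons defining
    the arrangement follow from the signs, magnitudes being positive. *)
Definition region_agree (R : realFieldType) n (x x' : 'rV[R]_n) : Prop :=
  (forall i, agree (centred x i) (centred x' i) /\ agree (mag x i - 1) (mag x' i - 1)) /\
  forall i j, i != j ->
    [/\ agree (mag x i - mag x j) (mag x' i - mag x' j),
        agree (mag x i - mag x j - 1) (mag x' i - mag x' j - 1) &
        agree (mag x i + mag x j - 1) (mag x' i + mag x' j - 1)].

Lemma agreexx (R : realFieldType) (p : R) : agree p p <-> p != 0.
Proof. by rewrite neq_lt /agree; split => [[[]|[]] -> //|/orP[]]; [rewrite orbT|left|right]. Qed.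

Lemma mag_pos (R : realFieldType) n (x : 'rV[R]_n) i :
  distinct x -> 0 < mag x i.
Proof. by case=> + _ => /(_ i); rewrite /mag normr_gt0. Qed.

Lemma region_agreexx (R : realFieldType) n (x : 'rV[R]_n) :
  region_agree x x <-> distinct x /\ generic_seq n (mags x).
Proof.
split=> [[S1 S2]|[dx [yinc ypos yd ys]]].
  have dx : distinct x.
    split=> [i|i j ij]; first by have [/agreexx] := S1 i.
    by apply/eqP/negPn/negP => /S2[/agreexx]; rewrite ij subrr eqxx.
  have yinc := mags_increasing dx.
  split => //; split => //.
  - move=> k /(index_mag_order_surj x)[i ->]; rewrite mags_index mag_pos //.
    by have [_ /agreexx] := S1 i; rewrite subr_eq0.
  - move=> k l /andP[kl ln].
    have [i iE] := index_mag_order_surj x (ltn_trans kl ln).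
    have [j jE] := index_mag_order_surj x ln.
    have ij : j != i by apply: contraTneq kl => ij; rewrite iE jE ij ltnn.
    have [_ /agreexx + _] := S2 j i ij.
    by rewrite iE jE !mags_index !neq_lt; lra.
  - move=> k l /andP[kl ln].
    have [i iE] := index_mag_order_surj x (ltn_trans kl ln).
    have [j jE] := index_mag_order_surj x ln.
    have ij : i != j by apply: contraTneq kl => ij; rewrite iE jE ij ltnn.
    by have [_ _ /agreexx] := S2 i j ij; rewrite iE jE !mags_index subr_eq0.
have dx' := dx; case: dx' => x0 xinj.
split=> [i|i j ij].
  split; apply/agreexx => //.
  have [_] := ypos _ (index_mag_order_lt x i); by rewrite mags_index subr_eq0.
have kl : index i (mag_order x) != index j (mag_order x).
  by apply/eqP => /index_mag_order_inj; apply/eqP.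
have pi := mag_pos i dx; have pj := mag_pos j dx.
have := index_mag_order_lt x i; have := index_mag_order_lt x j => jn in_.
split; apply/agreexx; first by rewrite subr_eq0; apply: contra_neq ij => /xinj.
  case: (ltngtP (index i (mag_order x)) (index j (mag_order x))) kl => // kl _.
    have := yinc _ _ (introT andP (conj kl jn)); rewrite !mags_index neq_lt; lra.
  have := yd _ _ (introT andP (conj kl in_)); rewrite !mags_index !neq_lt; lra.
case: (ltngtP (index i (mag_order x)) (index j (mag_order x))) kl => // kl _.
  have := ys _ _ (introT andP (conj kl jn)); rewrite !mags_index !neq_lt; lra.
have := ys _ _ (introT andP (conj kl in_)); rewrite !mags_index !neq_lt; lra.
Qed.

Lemma agree_lt (R : realFieldType) (a b c d : R) : agree (a - b) (c - d) -> (a < b) = (c < d).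
Proof. by case=> -[h1 h2]; apply/idP/idP; lra. Qed.

Lemma lt_agree (R : realFieldType) (a b c d : R) :
  a != b -> c != d -> (a < b) = (c < d) -> agree (a - b) (c - d).
Proof.
rewrite !neq_lt /agree => /orP[] h /orP[] h' e.
- by left; split; lra.
- by exfalso; lra.
- by exfalso; lra.
- by right; split; lra.
Qed.

(** This separates the three data of a region: the signs and the order of the magnitudes, which form
    a signed permutation, and the sign pattern of the increasing magnitudes. *)
Lemma region_agreeP (R : realFieldType) n (x x' : 'rV[R]_n) :
  distinct x -> generic_seq n (mags x) -> distinct x' -> generic_seq n (mags x') ->
  region_agree x x' <->
  [/\ signs x = signs x', mag_order x = mag_order x' & same_region n (mags x) (mags x')].
Proof.
move=> dx gx dx' gx'; split=> [[S1 S2]|[sE oE [lt1 step sum]]].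
  have oE : mag_order x = mag_order x'.
    congr (sort _ _); apply/funext => i; apply/funext => j; rewrite !leNgt; congr (~~ _).
    have [->|/S2[+ _ _]] := eqVneq j i; first by rewrite !ltxx.
    exact: agree_lt.
  split => //.
    by apply/ffunP => i; rewrite !ffunE; have [[[h1 h2]|[h1 h2]] _] := S1 i; apply/idP/idP; lra.
  have pairP k l : (k < l < n)%N -> exists i j, [/\ i != j,
      mags x k = mag x i, mags x' k = mag x' i, mags x l = mag x j & mags x' l = mag x' j].
    move=> /andP[kl ln].
    have [i iE] := index_mag_order_surj x (ltn_trans kl ln).
    have [j jE] := index_mag_order_surj x ln.
    exists i, j; split; rewrite ?iE ?jE ?mags_index ?oE ?mags_index //.
    by apply: contraTneq kl => ij; rewrite iE jE ij ltnn.
  split=> [k /(index_mag_order_surj x)[i ->]|k l /pairP[i [j [ij -> -> -> ->]]]|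
           k l /pairP[i [j [ij -> -> -> ->]]]].
  - by rewrite mags_index oE mags_index; have [_ /agree_lt] := S1 i.
  - rewrite eq_sym in ij; have [_ h _] := S2 j i ij.
    by case: h => -[h1 h2]; apply/idP/idP; lra.
  - by have [_ _ h] := S2 i j ij; case: h => -[h1 h2]; apply/idP/idP; lra.
have mE i : exists k, [/\ (k < n)%N, mags x k = mag x i, mags x' k = mag x' i
    & k = index i (mag_order x)].
  exists (index i (mag_order x)).
  by rewrite mags_index oE mags_index index_mag_order_lt.
have [[x0 _] [x0' _]] := (dx, dx').
have [/region_agreexx[G1 G2] /region_agreexx[G1' G2']] := (conj dx gx, conj dx' gx').
have [[yinc _ _ _] [yinc' _ _ _]] := (gx, gx').
split=> [i|i j ij].
  split; last first.
    have [_ /agreexx h] := G1 i; have [_ /agreexx h'] := G1' i; rewrite !subr_eq0 in h h'.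
    by apply: lt_agree => //; have [k [kn <- <- _]] := mE i; apply: lt1.
  move/ffunP: sE => /(_ i); rewrite !ffunE.
  by have := x0 i; have := x0' i; rewrite !neq_lt /agree => /orP[] ? /orP[] ?; lra.
have [k [kn kE kE' ki]] := mE i; have [l [ln lE lE' lj]] := mE j.
have [/agreexx h1 /agreexx h2 /agreexx h3] := G2 i j ij.
have [/agreexx h1' /agreexx h2' /agreexx h3'] := G2' i j ij.
move: h1 h2 h3 h1' h2' h3'; rewrite -!{}kE -!{}lE -!{}kE' -!{}lE'.
have kl : k != l by apply: contra_neq ij; rewrite ki lj; apply: index_mag_order_inj.
have near0 (p p' : R) : p != 0 -> p' != 0 -> (0 < p) = (0 < p') -> agree p p'.
  by rewrite !neq_lt /agree => /orP[] ? /orP[] ? e; lra.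
move: kl; rewrite neq_ltn => /orP[] kl h1 h2 h3 h1' h2' h3'.
  have kln := introT andP (conj kl ln).
  have yy := yinc _ _ kln; have yy' := yinc' _ _ kln; have e := sum _ _ kln.
  split; [by left; split; lra | by left; split; lra |].
  by apply: near0 => //; rewrite !subr_gt0.
have lkn := introT andP (conj kl kn).
have yy := yinc _ _ lkn; have yy' := yinc' _ _ lkn.
split; first by right; split; lra.
  by apply: near0 => //; rewrite -!addrA -!opprD !subr_gt0; apply: step.
by apply: near0 => //; rewrite !subr_gt0 ![mags _ k + _]addrC; apply: sum.
Qed.

(** The three data can be prescribed independently: [index i s] is the rank of the magnitude of
    coordinate [i], and subtracting 1/2 undoes [centred]. *)
Lemma point_of_data (R : realFieldType) n (e : {ffun 'I_n -> bool}) (s : seq 'I_n)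
    (y : nat -> R) :
  perm_eq s (enum 'I_n) -> increasing n y -> (forall k, (k < n)%N -> 0 < y k) ->
  exists x : 'rV[R]_n,
    [/\ distinct x, signs x = e, mag_order x = s & forall k, (k < n)%N -> mags x k = y k].
Proof.
move=> ps yinc ypos.
have sin i : i \in s by rewrite (perm_mem ps) mem_enum.
have ss : size s = n by rewrite (perm_size ps) size_enum_ord.
have su : uniq s by rewrite (perm_uniq ps) enum_uniq.
have idx i : (index i s < n)%N by rewrite -[X in (_ < X)%N]ss index_mem.
pose x : 'rV[R]_n := \row_i ((-1) ^+ (~~ e i) * y (index i s) - 1 / 2).
have xE i : centred x i = (-1) ^+ (~~ e i) * y (index i s) by rewrite /centred mxE subrK.
have mE i : mag x i = y (index i s).
  by rewrite /mag xE normrM normr_sign mul1r gtr0_norm ?ypos.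
have yinj i j : mag x i <= mag x j -> (index i s <= index j s)%N.
  by rewrite !mE leqNgt => h; apply/negP => ij;
    have := yinc _ _ (introT andP (conj ij (idx i))); lra.
have minj : injective (mag x).
  move=> i j ij; apply: (index_inj i (sin i) (sin j)); apply/eqP; rewrite eqn_leq.
  by rewrite !yinj ?ij.
have oE : mag_order x = s.
  rewrite /mag_order.
  have tot : total (fun i j => mag x i <= mag x j) by move=> ? ?; apply: le_total.
  have tr : transitive (fun i j => mag x i <= mag x j) by move=> ? ? ?; apply: le_trans.
  have anti : antisymmetric (fun i j => mag x i <= mag x j).
    by move=> i j /le_anti /minj.
  move/(perm_sortP tot tr anti): (ps) => <-; apply: sorted_sort => //.
  case sE: s => [//|i0 s']; rewrite -sE; apply/(sortedP i0) => k ks.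
  by rewrite !mE !index_uniq ?(ltnW ks) //; apply/ltW/yinc; rewrite ltnSn -ss.
exists x; split => //.
- split=> // i; rewrite xE mulf_neq0 ?signr_eq0 // gt_eqF ?ypos //.
- apply/ffunP => i; rewrite ffunE xE.
  by have := ypos _ (idx i); case: (e i); rewrite ?expr0 ?expr1; lra.
- move=> k kn; have [i kE] := index_mag_order_surj x kn.
  by rewrite kE mags_index mE oE.
Qed.

(** * Counting classes of points *)

Local Open Scope card_scope.
Local Open Scope classical_set_scope.

Lemma card_uniq_seq (T : eqType) (s : seq T) : uniq s -> [set x | x \in s] #= `I_(size s).
Proof.
case: s => [|x0 s] us.
  by rewrite (_ : [set x | _] = set0) ?II0 // -subset0.
rewrite (_ : [set x | _] = nth x0 (x0 :: s) @` `I_(size (x0 :: s))).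
  apply: inj_card_eq => i j; rewrite !inE => /= is_ js_ /eqP.
  by rewrite nth_uniq // => /eqP.
apply/seteqP; split=> [x /= xs|_ [i /= is_ <-]]; last exact: mem_nth.
by exists (index x (x0 :: s)); [apply: etrans (index_mem _ _) _ | apply: nth_index].
Qed.

(** Both maps have the same fibres on [P], so picking a preimage turns values of [g] bijectively
    into values of [f]. Elsewhere [h] defaults to [f x0], which is why an empty [P] is set apart. *)
Lemma card_image_by_code (X C T : Type) (P : set X) (g : X -> C) (f : X -> T) :
  (forall x y, P x -> P y -> g x = g y <-> f x = f y) -> g @` P #= f @` P.
Proof.
move=> gf; have [[x0 _]|P0] := pselect (exists x, P x); last first.
  by have -> : P = set0; [rewrite -subset0 => x Px; apply: P0; exists x | rewrite !image_set0].
pose h c := if pselect (exists2 x, P x & g x = c) is left e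
            then f (projT1 (cid2 e)) else f x0.
have hg x : P x -> h (g x) = f x.
  move=> Px; rewrite /h; case: pselect => [e|[]]; last by exists x.
  by case: cid2 => y Py gy /=; apply/(gf y x Py Px).
have -> : f @` P = h @` (g @` P).
  apply/seteqP; split=> [_ [x Px <-]|_ [_ [x Px <-] <-]].
    by exists (g x); [exists x | rewrite hg].
  by exists x; rewrite ?hg.
rewrite card_eq_sym; apply: inj_card_eq => c d; rewrite !inE => -[x Px <-{c}] [y Py <-{d}].
by rewrite !hg // => fxy; apply/gf.
Qed.

(** The count shared by regions and sketches: [g] sends a point to its class and [U] selects the
    admissible magnitudes. Invariance under changes beyond [n] is asked because [point_of_data]
    realizes a sequence only at indices below [n]. *)
Lemma card_signed_classes (R : realFieldType) (n : nat) (C : Type) (g : 'rV[R]_n -> C)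
    (U : (nat -> R) -> Prop) (code : (nat -> R) -> nat * (seq nat * seq bool)) :
  (forall y, U y -> increasing n y /\ forall k, (k < n)%N -> 0 < y k) ->
  (forall y, U y -> code y \in codes n) ->
  (forall c, c \in codes n -> exists2 y, U y & code y = c) ->
  (forall y y', (forall k, (k < n)%N -> y k = y' k) -> U y -> U y' /\ code y = code y') ->
  (forall x x', distinct x -> U (mags x) -> distinct x' -> U (mags x') ->
     g x = g x' <-> [/\ signs x = signs x', mag_order x = mag_order x' &
                        code (mags x) = code (mags x')]) ->
  g @` [set x | distinct x /\ U (mags x)] #= `I_(2 ^ n * n`! * 'C(2 * n, n))%N.
Proof.
move=> Upos Ucode Usurj Uext gE.
pose f (x : 'rV[R]_n) := (signs x, (mag_order x, code (mags x))).
have gf := @card_image_by_code _ _ _ [set x | distinct x /\ U (mags x)] g f.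
rewrite (card_eql (gf _)); last first.
  move=> x x' [dx Ux] [dx' Ux']; rewrite gE //.
  by rewrite /f; split=> [[-> -> ->]|[-> -> ->]].
pose s := [seq (e, p) | e <- enum {: {ffun 'I_n -> bool}},
             p <- [seq (o, c) | o <- permutations (enum 'I_n), c <- codes n]].
have -> : f @` [set x | distinct x /\ U (mags x)] = [set t | t \in s].
  apply/seteqP; split=> [_ [x [dx Ux] <-]|[e [o c]]] /=.
    apply: allpairs_f; first by rewrite mem_enum.
    by apply: allpairs_f; [rewrite mem_permutations perm_mag_order | apply: Ucode].
  case/allpairsP => -[e' p] /= [_ /allpairsP[[o' c'] /= [+ cin ->]] [-> -> ->]].
  rewrite mem_permutations => po; have [y Uy <-] := Usurj _ cin.
  have [yinc ypos] := Upos y Uy.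
  have [x [dx xs xo xy]] := point_of_data e' po yinc ypos.
  have [Ux yE] := Uext y (mags x) (fun k kn => esym (xy k kn)) Uy.
  by exists x; rewrite // /f xs xo yE.
have -> : (2 ^ n * n`! * 'C(2 * n, n))%N = size s.
  rewrite !size_allpairs size_codes size_permutations ?enum_uniq // size_enum_ord mulnA.
  by rewrite -cardE card_ffun card_bool card_ord.
apply: card_uniq_seq; apply: allpairs_uniq; first exact: enum_uniq.
  apply: allpairs_uniq; [exact: permutations_uniq | exact: codes_uniq |].
  by move=> [? ?] [? ?].
by move=> [? ?] [? ?].
Qed.

Lemma generic_seq_ext (R : realFieldType) n (y y' : nat -> R) :
  (forall k, (k < n)%N -> y k = y' k) -> generic_seq n y -> generic_seq n y'.
Proof.
move=> yy' [yinc ypos yd ys].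
have yy2 i j : (i < j < n)%N -> y' i = y i /\ y' j = y j.
  by move=> ij; rewrite !yy' //; lia.
split=> [i j ij|k kn|i j ij|i j ij]; last by have [-> ->] := yy2 i j ij; apply: ys.
- by have [-> ->] := yy2 i j ij; apply: yinc.
- by rewrite -yy' //; apply: ypos.
- by have [-> ->] := yy2 i j ij; apply: yd.
Qed.

Lemma same_region_ext (R : realFieldType) n (y y' : nat -> R) :
  (forall k, (k < n)%N -> y k = y' k) -> same_region n y y'.
Proof. by move=> yy'; split=> [k kn|i j ij|i j ij]; rewrite !yy' //; lia. Qed.

(** * Regions as sign classes of affine forms *)

Definition affine_form (R : realType) n (a b c : R) (i j : 'I_n) (x : 'rV[R]_n) : R :=
  a * x 0 i + b * x 0 j - c.

Lemma affine_form_continuous (R : realType) n a b c i j :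
  continuous (@affine_form R n a b c i j).
Proof.
move=> x; have cx k : (fun y : 'rV[R]_n => y 0 k) @ nbhs x --> x 0 k.
  exact: coord_continuous.
apply: (@cvgB R R _ (nbhs x) _ (fun y : 'rV[R]_n => a * y 0 i + b * y 0 j) (fun=> c)).
  apply: (@cvgD R R _ (nbhs x) _ (fun y : 'rV[R]_n => a * y 0 i) (fun y => b * y 0 j)).
    by apply: (@cvgM R _ (nbhs x) _ (fun=> a)); [exact: cvg_cst | exact: cx].
  by apply: (@cvgM R _ (nbhs x) _ (fun=> b)); [exact: cvg_cst | exact: cx].
exact: cvg_cst.
Qed.

Definition forms_B (R : realType) n : set ('rV[R]_n -> R) :=
  [set l | exists (i : 'I_n) (c : R), c \in [:: - (3 / 2); - (1 / 2); 1 / 2] /\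
            l = affine_form 1 0 c i i] `|`
  [set l | exists (i j : 'I_n) (c : R), [/\ (i < j)%N, c \in [:: -2; -1; 0] &
            l = affine_form 1 1 c i j]] `|`
  [set l | exists (i j : 'I_n) (c : R), [/\ (i < j)%N, c \in [:: -1; 0; 1] &
            l = affine_form 1 (-1) c i j]].

Lemma complement_B (R : realType) n (x : 'rV[R]_n) :
  arrangement_complement (arrangement_B R n) x <->
  forall l, forms_B l -> l x != 0.
Proof.
split=> [cx l|lx].
  move=> fl; apply/eqP => lx0; apply: cx.
  case: fl lx0 => [[]|] [i].
  - move=> [c [cin ->]] e; exists [set x : 'rV[R]_n | x 0 i = c].
      by left; left; exists i, c.
    by rewrite /affine_form /= in e *; lra.
  - move=> [j [c [ij cin ->]]] e; exists [set x : 'rV[R]_n | x 0 i + x 0 j = c].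
      by left; right; exists i, j; split => //; exists c.
    by rewrite /affine_form /= in e *; lra.
  - move=> [j [c [ij cin ->]]] e; exists [set x : 'rV[R]_n | x 0 i - x 0 j = c].
      by right; exists i, j; split => //; exists c.
    by rewrite /affine_form /= in e *; lra.
case=> H [[[i [c cin ->]]|[i [j [ij [c cin ->]]]]]|[i [j [ij [c cin ->]]]]] /= e.
- have := lx (affine_form 1 0 c i i) ltac:(by left; left; exists i, c).
  by rewrite /affine_form; lra.
- have := lx (affine_form 1 1 c i j) ltac:(by left; right; exists i, j, c).
  by rewrite /affine_form; lra.
- have := lx (affine_form 1 (-1) c i j) ltac:(by right; exists i, j, c).
  by rewrite /affine_form; lra.
Qed.

(** The image of a connected set under a form is an interval; if it avoids 0, the sign is constant.
    Conversely, along a segment a form takes convex combinations of its end values, so a segment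
    joining two points with the same signs meets no hyperplane. *)
Lemma same_component_agree (R : realType) n (x x' : 'rV[R]_n) :
  let U := arrangement_complement (arrangement_B R n) in
  U x -> U x' -> connected_component U x = connected_component U x' <->
  forall l, forms_B l -> agree (l x) (l x').
Proof.
move=> U Ux Ux'.
have affine l : forms_B l -> exists a b c i j, l = @affine_form R n a b c i j.
  by case=> [[]|] [i]; [move=> [c [_ ->]]|move=> [j [c [_ _ ->]]]..];
    do 5!eexists; reflexivity.
split=> [xx' l fl|xx'].
  have [B [Bx BU Bc] Bx'] : connected_component U x x'.
    by rewrite xx'; apply: connected_component_refl.
  have [a [b [c [i [j lE]]]]] := affine l fl.
  have : connected (l @` B).
    apply: connected_continuous_connected => //; apply: continuous_subspaceT.
    by rewrite lE; apply: affine_form_continuous.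
  move/connected_intervalP => lB.
  have lx : l x != 0 by move/complement_B: Ux; apply.
  have lx' : l x' != 0 by move/complement_B: Ux'; apply.
  have B0 : ~ (l @` B) 0.
    by case=> y By ly; move/complement_B: (BU y By) => /(_ l fl); rewrite ly eqxx.
  have Bl : (l @` B) (l x) by exists x.
  have Bl' : (l @` B) (l x') by exists x'.
  move: lx lx'; rewrite !neq_lt => /orP[] h /orP[] h'; [by left| | |by right].
    by case: B0; apply: (lB _ _ Bl Bl'); rewrite !ltW.
  by case: B0; apply: (lB _ _ Bl' Bl); rewrite !ltW.
apply: same_connected_component.
pose p (t : R) : 'rV[R]_n := x + t *: (x' - x).
exists (p @` `[0, 1]); last first.
  by exists 1; rewrite /p /= ?in_itv /= ?ler01 ?lexx // scale1r addrC subrK.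
split; first by exists 0; rewrite /p /= ?in_itv /= ?ler01 ?lexx // scale0r addr0.
  move=> _ [t /= + <-]; rewrite in_itv /= => /andP[t0 t1]; apply/complement_B => l fl.
  have [a [b [c [i [j lE]]]]] := affine l fl.
  have -> : l (p t) = (1 - t) * l x + t * l x'.
    by rewrite lE /affine_form /p !mxE; ring.
  rewrite neq_lt; have [[h h']|[h h']] := xx' l fl.
    by apply/orP; left; nra.
  by apply/orP; right; nra.
apply: connected_continuous_connected; first exact: segment_connected.
apply: continuous_subspaceT => t; apply: cvgD; first exact: cvg_cst.
by apply: cvgZ; [exact: cvg_id | exact: cvg_cst].
Qed.

Lemma agree_mag (R : realFieldType) n (x x' : 'rV[R]_n) i :
  agree (centred x i) (centred x' i) ->
  [/\ x 0 i + 1 / 2 < 0, mag x i = - x 0 i - 1 / 2, x' 0 i + 1 / 2 < 0 &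
      mag x' i = - x' 0 i - 1 / 2] \/
  [/\ 0 < x 0 i + 1 / 2, mag x i = x 0 i + 1 / 2, 0 < x' 0 i + 1 / 2 &
      mag x' i = x' 0 i + 1 / 2].
Proof.
rewrite /mag /centred => -[[h h']|[h h']]; [left|right]; split => //.
- by rewrite ltr0_norm //; lra.
- by rewrite ltr0_norm //; lra.
- by rewrite gtr0_norm.
- by rewrite gtr0_norm.
Qed.

(** The constant -1/2 gives the signs, and -3/2 and 1/2 compare magnitudes with 1. For two
    coordinates of equal sign, sums and differences correspond to sums and differences of
    magnitudes; for opposite signs the two roles are exchanged. *)
Lemma forms_B_agree (R : realType) n (x x' : 'rV[R]_n) :
  (forall l, forms_B l -> agree (l x) (l x')) <-> region_agree x x'.
Proof.
split=> [h|[S1 S2] l].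
  have h1 i c : c \in [:: - (3 / 2); - (1 / 2); 1 / 2] -> agree (x 0 i - c) (x' 0 i - c).
    move=> cin; have := h (affine_form 1 0 c i i) ltac:(by left; left; exists i, c).
    by rewrite /affine_form !mul1r !mul0r !addr0.
  have h2 i j c : i != j -> c \in [:: -2; -1; 0] ->
      agree (x 0 i + x 0 j - c) (x' 0 i + x' 0 j - c).
    rewrite neq_ltn => /orP[] ij cin.
      have := h (affine_form 1 1 c i j) ltac:(by left; right; exists i, j, c).
      by rewrite /affine_form !mul1r.
    have := h (affine_form 1 1 c j i) ltac:(by left; right; exists j, i, c).
    by rewrite /affine_form !mul1r (addrC (x 0 j)) (addrC (x' 0 j)).
  have h3 i j c : i != j -> c \in [:: -1; 0; 1] ->
      agree (x 0 i - x 0 j - c) (x' 0 i - x' 0 j - c).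
    rewrite neq_ltn => /orP[] ij cin.
      have := h (affine_form 1 (-1) c i j) ltac:(by right; exists i, j, c).
      by rewrite /affine_form !mul1r !mulN1r.
    have cin' : - c \in [:: -1; 0; 1].
      by move: cin; rewrite !inE => /or3P[] /eqP->; rewrite ?opprK ?oppr0 eqxx ?orbT.
    have := h (affine_form 1 (-1) (- c) j i) ltac:(by right; exists j, i, (- c)).
    by rewrite /affine_form /agree; lra.
  have sgn i : agree (centred x i) (centred x' i).
    have := h1 i (- (1 / 2)); rewrite !inE eqxx orbT /centred /agree => /(_ isT); lra.
  split=> [i|i j ij].
    split => //.
    have := h1 i (- (3 / 2)); have := h1 i (1 / 2).
    rewrite !inE !eqxx !orbT /agree => /(_ isT) a1 /(_ isT) a2.
    by case: (agree_mag (sgn i)) => -[p -> p' ->]; lra.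
  have := h2 i j 0 ij; have := h2 i j (-1) ij; have := h2 i j (-2) ij.
  have := h3 i j 0 ij; have := h3 i j (-1) ij; have := h3 i j 1 ij.
  rewrite !inE !eqxx !orbT /agree.
  move=> /(_ isT) d1 /(_ isT) dm /(_ isT) d0 /(_ isT) s2 /(_ isT) s1 /(_ isT) s0.
  case: (agree_mag (sgn i)) => -[p -> p' ->]; case: (agree_mag (sgn j)) => -[q -> q' ->].
  - by split; [clear -d0 | clear -dm | clear -s2]; lra.
  - by split; [clear -s1 | clear -s2 | clear -dm]; lra.
  - by split; [clear -s1 | clear -s0 | clear -d1]; lra.
  - by split; [clear -d0 | clear -d1 | clear -s0]; lra.
have pairs i j : i != j -> [/\ agree (x 0 i + x 0 j + 2) (x' 0 i + x' 0 j + 2),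
    agree (x 0 i + x 0 j + 1) (x' 0 i + x' 0 j + 1),
    agree (x 0 i + x 0 j) (x' 0 i + x' 0 j),
    agree (x 0 i - x 0 j) (x' 0 i - x' 0 j) &
    agree (x 0 i - x 0 j - 1) (x' 0 i - x' 0 j - 1) /\
    agree (x 0 i - x 0 j + 1) (x' 0 i - x' 0 j + 1)].
  move=> ij; have [m0 m1 p1] := S2 i j ij; rewrite eq_sym in ij; have [_ m2 _] := S2 j i ij.
  have [si _] := S1 i; have [sj _] := S1 j; move: m0 m1 m2 p1.
  case: (agree_mag si) => -[p -> p' ->]; case: (agree_mag sj) => -[q -> q' ->];
    rewrite /agree => m0 m1 m2 p1; clear -p p' q q' m0 m1 m2 p1.
  - by split; [clear m0 m1 m2 | clear m0 m1 m2 p1 | clear m0 m1 m2 p1 | clear m1 m2 p1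
      | split; [clear m0 m1 p1 | clear m0 m2 p1]]; lra.
  - by split; [clear m0 m2 p1 | clear m1 m2 p1 | clear m0 m1 p1 | clear m1 m2 p1
      | split; [clear m0 m1 m2 p1 | clear m0 m1 m2]]; lra.
  - by split; [clear m0 m1 p1 | clear m1 m2 p1 | clear m0 m2 p1 | clear m1 m2 p1
      | split; [clear m0 m1 m2 | clear m0 m1 m2 p1]]; lra.
  - by split; [clear m0 m1 m2 p1 | clear m0 m1 m2 p1 | clear m0 m1 m2 | clear m1 m2 p1
      | split; [clear m0 m2 p1 | clear m0 m1 p1]]; lra.
case=> [[]|] [i].
- move=> [c [cin ->]]; rewrite /affine_form !mul1r !mul0r !addr0.
  have [si mi] := S1 i; move: mi; move: cin; rewrite !inE.
  by case: (agree_mag si) => -[p -> p' ->] /or3P[] /eqP ->; rewrite /agree; lra.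
- move=> [j [c [ij cin ->]]]; rewrite /affine_form !mul1r.
  have [s2 s1 s0 _ _] := pairs i j ltac:(by rewrite neq_ltn ij).
  by move: cin; rewrite !inE => /or3P[] /eqP ->; rewrite ?opprK ?subr0.
- move=> [j [c [ij cin ->]]]; rewrite /affine_form !mul1r !mulN1r.
  have [_ _ _ d0 [d1 dm]] := pairs i j ltac:(by rewrite neq_ltn ij).
  by move: cin; rewrite !inE => /or3P[] /eqP ->; rewrite ?opprK ?subr0.
Qed.

Lemma card_regions_B (R : realType) n :
  regions (arrangement_B R n) #= `I_(2 ^ n * n`! * 'C(2 * n, n))%N.
Proof.
have cP (x : 'rV[R]_n) : arrangement_complement (arrangement_B R n) x <->
    distinct x /\ generic_seq n (mags x).
  rewrite -region_agreexx -forms_B_agree complement_B.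
  by split=> h l fl; [apply/agreexx | apply/agreexx]; apply: h.
rewrite /regions (_ : arrangement_complement _ =
    [set x | distinct x /\ generic_seq n (mags x)]); last first.
  by apply/seteqP; split=> x /cP.
apply: (card_signed_classes (code := region_code n)).
- by move=> y [yinc ypos _ _]; split => // k /ypos[].
- by move=> y [yinc _ _ _]; apply: region_code_mem.
- exact: region_code_surj.
- move=> y y' yy' gy; have gy' := generic_seq_ext yy' gy; split => //.
  by apply/region_codeP => //; apply: same_region_ext.
- move=> x x' dx gx dx' gx'.
  have Ux := (cP x).2 (conj dx gx); have Ux' := (cP x').2 (conj dx' gx').
  have -> : [set x | distinct x /\ generic_seq n (mags x)] =
      arrangement_complement (arrangement_B R n).
    by apply/seteqP; split=> y /cP.
  rewrite same_component_agree // forms_B_agree.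
  split=> [/(region_agreeP dx gx dx' gx')[sE oE /(region_codeP gx gx') cE]|] //.
  by move=> [sE oE /(region_codeP gx gx') cE]; apply/region_agreeP.
Qed.

(** * Sketches *)

(** The finer pattern visible in a sketch: the value 2 comes from comparing a letter with the
    constants of absolute value 3/2, and 1/2 from comparing two letters of the same coordinate. *)
Definition sketch_agree (R : realFieldType) n (x x' : 'rV[R]_n) : Prop :=
  region_agree x x' /\ forall i, agree (mag x i - 1 / 2) (mag x' i - 1 / 2) /\
                                 agree (mag x i - 2) (mag x' i - 2).

Lemma sketch_agreexx (R : realFieldType) n (x : 'rV[R]_n) :
  sketch_agree x x <-> [/\ distinct x, generic_seq n (mags x) &
    forall k, (k < n)%N -> mags x k != 1 / 2 /\ mags x k != 2].
Proof.
split=> [[/region_agreexx[dx gx] S]|[dx gx h]].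
  split => // k /(index_mag_order_surj x)[i ->]; rewrite mags_index.
  by have [/agreexx + /agreexx] := S i; rewrite !subr_eq0.
split; first exact/region_agreexx.
move=> i; have [] := h _ (index_mag_order_lt x i); rewrite mags_index => h1 h2.
by split; apply/agreexx; rewrite subr_eq0.
Qed.

Lemma sketch_agreeP (R : realFieldType) n (x x' : 'rV[R]_n) :
  sketch_agree x x -> sketch_agree x' x' ->
  sketch_agree x x' <->
  [/\ signs x = signs x', mag_order x = mag_order x' & same_sketch n (mags x) (mags x')].
Proof.
move=> sx sx'; have /sketch_agreexx[dx gx hx] := sx; have /sketch_agreexx[dx' gx' hx'] := sx'.
split=> [[/(region_agreeP dx gx dx' gx')[sE oE ss] S]|[sE oE [ss lth lt2]]].
  split => //; split => // k /(index_mag_order_surj x)[i ->];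
    by rewrite mags_index oE mags_index; have [/agree_lt h1 /agree_lt h2] := S i.
split; first exact/region_agreeP.
have [_ Sx] := sx; have [_ Sx'] := sx'.
move=> i; have [/agreexx h1 /agreexx h2] := Sx i; have [/agreexx h1' /agreexx h2'] := Sx' i.
rewrite !subr_eq0 in h1 h2 h1' h2'.
have := lth _ (index_mag_order_lt x i); have := lt2 _ (index_mag_order_lt x i).
by rewrite mags_index oE mags_index => e1 e2; split; apply: lt_agree.
Qed.

(* The letter of value [(if s then m else - m) + (if t then 1 / 2 else - (1 / 2))]
   where [m] is the magnitude of the [i]-th coordinate and [e] tells whether that
   coordinate is positive. *)
Definition abs_letter n (e : bool) (i : 'I_n) (s t : bool) : letter n :=
  if s == e then pos_letter i t else neg_letter i (~~ t).

Definition abs_val (R : realFieldType) (m : R) (s t : bool) : R :=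
  (if s then m else - m) + (if t then 1 / 2 else - (1 / 2)).

Lemma letter_val_abs (R : realType) n (x : 'rV[R]_n) i s t :
  centred x i != 0 ->
  letter_val x (abs_letter (0 < centred x i) i s t) = abs_val (mag x i) s t.
Proof.
rewrite /abs_letter /abs_val /mag neq_lt => /orP[] h.
  rewrite ltr0_norm //; rewrite ltNge ltW //=; rewrite /centred in h *.
  by case: s t => [] [] /=; lra.
rewrite gtr0_norm // h; rewrite /centred in h *.
by case: s t => [] [] /=; lra.
Qed.

Lemma ab_of_abs_letter n e (i : 'I_n) s t :
  ab_of_letter (abs_letter e i s t) = if t then beta else alpha.
Proof. by rewrite /abs_letter; case: e s t => [] [] []. Qed.

Lemma abs_letterP n (e : 'I_n -> bool) (a : letter n) :
  (exists i s t, a = abs_letter (e i) i s t) \/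
  [\/ a = minus_three_halves, a = minus_half, a = plus_half | a = plus_three_halves].
Proof.
case: a => [i t|i t||||].
- by left; exists i, (e i), t; rewrite /abs_letter eqxx.
- left; exists i, (~~ e i), (~~ t).
  by rewrite /abs_letter negbK; case: (e i).
- by right; constructor 1.
- by right; constructor 2.
- by right; constructor 3.
- by right; constructor 4.
Qed.

Definition letters_agree (R : realType) n (x x' : 'rV[R]_n) : Prop :=
  forall a b, a != b ->
    agree (letter_val x a - letter_val x b) (letter_val x' a - letter_val x' b).

Lemma abs_letter_inj n e (i : 'I_n) s t s' t' :
  abs_letter e i s t = abs_letter e i s' t' -> (s, t) = (s', t').
Proof. by rewrite /abs_letter; case: e s t s' t' => [] [] [] [] []. Qed.

Lemma abs_letter_neq n e (i j : 'I_n) s t s' t' :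
  i != j -> abs_letter (e i) i s t != abs_letter (e j) j s' t'.
Proof.
by rewrite /abs_letter => ij; apply/eqP; case: ifP => _; case: ifP => _ // -[/eqP];
  rewrite (negbTE ij).
Qed.

Lemma agreeN (R : realFieldType) (p q : R) : agree (- p) (- q) -> agree p q.
Proof. by rewrite /agree; lra. Qed.

(** The values of letters of a coordinate are its magnitude or the opposite, shifted by 1/2 or -1/2.
    Comparing letters of two coordinates thus amounts to comparing sums and differences of
    magnitudes with -1, 0 and 1. *)
Lemma letters_agreeP (R : realType) n (x x' : 'rV[R]_n) :
  letters_agree x x' <-> sketch_agree x x'.
Proof.
split=> [h|[[S1 S2] S3]].
  have sgn i : agree (centred x i) (centred x' i).
    have := h (pos_letter i false) minus_half isT.
    by rewrite /centred /agree /=; lra.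
  pose e i := 0 < centred x i.
  have vE i s t : letter_val x (abs_letter (e i) i s t) = abs_val (mag x i) s t.
    by rewrite letter_val_abs //; have := sgn i; rewrite neq_lt /agree; lra.
  have vE' i s t : letter_val x' (abs_letter (e i) i s t) = abs_val (mag x' i) s t.
    rewrite (_ : e i = (0 < centred x' i)) ?letter_val_abs //; last first.
      by have := sgn i; rewrite /agree /e => -[[h1 h2]|[h1 h2]]; apply/idP/idP; lra.
    by have := sgn i; rewrite neq_lt /agree; lra.
  have neqc i s t : [/\ abs_letter (e i) i s t != plus_half &
      abs_letter (e i) i s t != plus_three_halves].
    by rewrite /abs_letter; case: ifP.
  have hh i : [/\ agree (mag x i - 1) (mag x' i - 1),
      agree (mag x i - 1 / 2) (mag x' i - 1 / 2) & agree (mag x i - 2) (mag x' i - 2)].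
    have [n1 n2] := neqc i true false.
    have := h _ _ n1; have := h _ _ n2; rewrite !vE !vE' /abs_val /=.
    have n3 : abs_letter (e i) i true false != abs_letter (e i) i false true.
      by apply/eqP => /abs_letter_inj.
    have := h _ _ n3; rewrite !vE !vE' /abs_val /agree /= => a1 a2 a3.
    by split; [clear a1 a2 | clear a2 a3 | clear a1 a3]; lra.
  split; last by move=> i; have [] := hh i.
  split=> [i|i j ij]; first by have [] := hh i.
  have := h _ _ (abs_letter_neq e true false true false ij).
  have := h _ _ (abs_letter_neq e true false true true ij).
  have := h _ _ (abs_letter_neq e true false false true ij).
  rewrite !vE !vE' /abs_val /agree /= => a1 a2 a3.
  by split; [clear a1 a2 | clear a1 a3 | clear a2 a3]; lra.
pose e i := 0 < centred x i.
have vE i s t : letter_val x (abs_letter (e i) i s t) = abs_val (mag x i) s t.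
  by rewrite letter_val_abs //; have [+ _] := S1 i; rewrite neq_lt /agree; lra.
have vE' i s t : letter_val x' (abs_letter (e i) i s t) = abs_val (mag x' i) s t.
  rewrite (_ : e i = (0 < centred x' i)) ?letter_val_abs //; last first.
    by have [+ _] := S1 i; rewrite /agree /e => -[[h1 h2]|[h1 h2]]; apply/idP/idP; lra.
  by have [+ _] := S1 i; rewrite neq_lt /agree; lra.
have pos i : 0 < mag x i /\ 0 < mag x' i.
  rewrite !normr_gt0; have [+ _] := S1 i.
  by rewrite !neq_lt /agree; case=> -[-> ->]; rewrite ?orbT.
have consts i b s t :
    [\/ b = minus_three_halves, b = minus_half, b = plus_half | b = plus_three_halves] ->
    agree (letter_val x (abs_letter (e i) i s t) - letter_val x b)
          (letter_val x' (abs_letter (e i) i s t) - letter_val x' b).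
  rewrite vE vE' /abs_val; have [p p'] := pos i; have [_ a1] := S1 i; have [_ a2] := S3 i.
  clear -p p' a1 a2; rewrite /agree in a1 a2 *.
  by case=> ->; case: s; case: t => /=; lra.
move=> a b ab; case: (abs_letterP e a) ab => [[i [s [t ->]]]|ca];
  case: (abs_letterP e b) => [[j [s' [t' ->]]]|cb] ab; last first.
- rewrite /agree; clear -ca cb ab.
  by case: ca ab => ->; case: cb => -> //= _; lra.
- by apply: agreeN; rewrite !opprB; apply: consts.
- exact: consts.
rewrite !vE !vE' /abs_val; have [p p'] := pos i; have [q q'] := pos j.
have [ij|ij] := eqVneq i j.
  have [+ _] := S3 i; move: ab; rewrite -ij; clear -p p'.
  by case: s; case: t; case: s'; case: t'; rewrite ?eqxx //= => _ h; rewrite /agree in h *; lra.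
have [m0 m1 p1] := S2 i j ij; rewrite eq_sym in ij; have [_ m2 _] := S2 j i ij.
clear -m0 m1 p1 m2 p p' q q'; rewrite /agree in m0 m1 m2 p1 *.
case: s; case: s'.
- by clear p1; case: t; case: t' => /=; [clear m1 m2|clear m0 m1|clear m0 m2|clear m1 m2]; lra.
- by clear m0 m1 m2; case: t; case: t' => /=; lra.
- by clear m0 m1 m2; case: t; case: t' => /=; lra.
- by clear p1; case: t; case: t' => /=; [clear m1 m2|clear m0 m2|clear m0 m1|clear m1 m2]; lra.
Qed.

(** * Sketches as sorted words *)

Definition sketch_of (R : realType) n (x : 'rV[R]_n) : seq (letter n) :=
  sort (fun a b => letter_val x a <= letter_val x b) (enum {: letter n}).

Lemma letters_agreexx (R : realType) n (x : 'rV[R]_n) :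
  letters_agree x x <-> injective (letter_val x).
Proof.
split=> [h a b|h a b ab].
  by apply: contra_eq => /h/agreexx; rewrite subr_eq0.
by apply/agreexx; rewrite subr_eq0; apply: contra_neq ab; apply: h.
Qed.

Lemma index_sketch_of (R : realType) n (x : 'rV[R]_n) a b :
  injective (letter_val x) ->
  (index a (sketch_of x) < index b (sketch_of x))%N = (letter_val x a < letter_val x b).
Proof.
move=> xinj; have tr : transitive (fun a b => letter_val x a <= letter_val x b).
  by move=> ? ? ?; apply: le_trans.
have srt : sorted (fun a b => letter_val x a <= letter_val x b) (sketch_of x).
  by apply: sort_sorted => ? ?; apply: le_total.
have inS c : c \in sketch_of x by rewrite mem_sort mem_enum.
have lt_le c d : (index c (sketch_of x) < index d (sketch_of x))%N ->
    letter_val x c <= letter_val x d.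
  exact: (sorted_ltn_index tr srt _ _ (inS c) (inS d)).
case: (ltngtP (index a (sketch_of x)) (index b (sketch_of x))) => [ab|ba|].
- rewrite lt_neqAle lt_le // andbT; apply/esym/eqP => /xinj e; by rewrite e ltnn in ab.
- by rewrite ltNge lt_le.
- by move/(index_inj a (inS a) (inS b)) => ->; rewrite ltxx.
Qed.

Lemma sketch_of_eq (R : realType) n (x x' : 'rV[R]_n) :
  injective (letter_val x) -> injective (letter_val x') ->
  sketch_of x = sketch_of x' <-> letters_agree x x'.
Proof.
move=> xinj xinj'; split=> [e a b ab|h].
  have ne := contra_neq (@xinj a b) ab; have ne' := contra_neq (@xinj' a b) ab.
  by apply: lt_agree => //; rewrite -!index_sketch_of // e.
congr (sort _ _); apply/funext => a; apply/funext => b; rewrite !leNgt; congr (~~ _).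
by have [->|/h/agree_lt //] := eqVneq b a; rewrite !ltxx.
Qed.

(** A strictly sorted word forces distinct values, and then the sorted word is unique. So the
    pointed symmetric sketches are the words [sketch_of x] for the points [x] that separate the
    letters. *)
Lemma sorted_sketchP (R : realType) n (x : 'rV[R]_n) w :
  (perm_eq w (enum {: letter n}) /\
   sorted (fun a b => letter_val x a < letter_val x b) w) <->
  (injective (letter_val x) /\ w = sketch_of x).
Proof.
have sE s : sorted (fun a b => letter_val x a < letter_val x b) s =
    uniq (map (letter_val x) s) && sorted (fun a b => letter_val x a <= letter_val x b) s.
  have e (r : rel R) : sorted (fun a b => r (letter_val x a) (letter_val x b)) s =
      sorted r (map (letter_val x) s) by rewrite sorted_map.
  by rewrite (e <%O) (e <=%O) lt_sorted_uniq_le.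
rewrite sE; split=> [[pw /andP[uw sw]]|[xinj ->]].
  have xinj : injective (letter_val x).
    by apply/injectiveP; rewrite /injectiveb /dinjectiveb -(perm_uniq (perm_map _ pw)).
  split => //; apply: (sorted_eq (leT := fun a b => letter_val x a <= letter_val x b)) => //.
  - by move=> ? ? ?; apply: le_trans.
  - by move=> a b /le_anti/xinj.
  - by apply: sort_sorted => ? ?; apply: le_total.
  - by rewrite perm_sym perm_sort perm_sym.
rewrite perm_sort perm_refl (map_inj_uniq xinj) sort_uniq enum_uniq; split => //=.
by apply: sort_sorted => ? ?; apply: le_total.
Qed.

(** * The first half of a sketch *)

Definition opp_letter n (a : letter n) : letter n :=
  match a with
  | pos_letter i s => neg_letter i s
  | neg_letter i s => pos_letter i s
  | minus_three_halves => plus_three_halves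
  | minus_half => plus_half
  | plus_half => minus_half
  | plus_three_halves => minus_three_halves
  end.

Lemma opp_letterK n : involutive (@opp_letter n).
Proof. by case. Qed.

Lemma letter_val_opp (R : realType) n (x : 'rV[R]_n) a :
  letter_val x (opp_letter a) = - letter_val x a.
Proof. by case: a => [i s|i s||||] /=; lra. Qed.

(** Taking opposites exchanges negative and positive letters, and no letter has value 0, since it
    would share it with its opposite. Hence the first half of the word consists of the negative
    letters. *)
Lemma card_negative_letters (R : realType) n (x : 'rV[R]_n) :
  injective (letter_val x) -> #|[pred a | letter_val x a < 0]| = (2 * n + 2)%N.
Proof.
move=> xinj; set N := [pred a | _].
have NC : #|[predC N]| = #|N|.
  rewrite -(fintype.card_image (inv_inj (@opp_letterK n)) N); apply: eq_card => a.
  rewrite -[a]opp_letterK fintype.mem_image ?inE; last exact: inv_inj (@opp_letterK n).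
  rewrite letter_val_opp oppr_lt0 -leNgt; apply/idP/idP; last exact: ltW.
  rewrite le_eqVlt => /orP[/eqP e|//]; have h := letter_val_opp x (opp_letter a).
  have /xinj : letter_val x (opp_letter (opp_letter a)) = letter_val x (opp_letter a).
    by rewrite h e oppr0.
  by case: (a).
by have := cardC N; rewrite NC card_letter => h; apply: double_inj; rewrite -addnn h; lia.
Qed.

Lemma take_sorted_lt (T : Type) (R : realFieldType) (f : T -> R) (c : R) (s : seq T) :
  sorted (fun a b => f a < f b) s ->
  [seq a <- s | f a < c] = take (count (fun a => f a < c) s) s.
Proof.
have tr : transitive (fun a b => f a < f b) by move=> ? ? ?; apply: lt_trans.
elim: s => //= a s IHs pas; have [ac|ca] := ltP (f a) c.
  by rewrite add1n /= IHs // (path_sorted pas).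
have no : ~~ has (fun a => f a < c) s.
  rewrite -all_predC; apply: sub_all (order_path_min tr pas) => b /= ab.
  by rewrite -leNgt; apply/ltW/(le_lt_trans ca ab).
rewrite IHs ?(path_sorted pas) //.
have -> : count (fun a => f a < c) s = 0%N by apply/eqP; rewrite -leqn0 leqNgt -has_count.
by rewrite take0.
Qed.

Lemma ab_word_negative (R : realType) n (x : 'rV[R]_n) :
  injective (letter_val x) ->
  ab_word (sketch_of x) =
  [seq ab_of_letter a | a <- [seq a <- sketch_of x | letter_val x a < 0]].
Proof.
move=> xinj; have [pw srt] := (sorted_sketchP x (sketch_of x)).2 (conj xinj erefl).
rewrite /ab_word (take_sorted_lt _ srt); congr (map _ (take _ _)).
by rewrite (permP pw) -(card_negative_letters xinj) enumT cardE /enum_mem size_filter.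
Qed.

Lemma last_maximum (T : eqType) (R : realFieldType) (f : T -> R) (s : seq T) (a : T) :
  sorted (fun a b => f a < f b) s -> a \in s -> (forall b, b \in s -> f b <= f a) ->
  exists s', s = rcons s' a.
Proof.
case/lastP: s => // s z; rewrite sorted_pairwise => [|? ? ?]; last exact: lt_trans.
rewrite pairwise_rcons => /andP[/allP sz _]; rewrite mem_rcons inE => /orP[/eqP->|az] h.
  by exists s.
by have := h z; rewrite mem_rcons mem_head leNgt sz // => /(_ isT).
Qed.

Lemma last_beta_sketch (R : realType) n (x : 'rV[R]_n) : injective (letter_val x) ->
  (exists u c, ab_word (sketch_of x) = rcons u c /\ is_beta c) <->
  exists a, [/\ letter_val x a < 0, is_beta (ab_of_letter a) &
                forall b, letter_val x b < 0 -> letter_val x b <= letter_val x a].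
Proof.
move=> xinj; rewrite ab_word_negative //.
have [pw srt] := (sorted_sketchP x (sketch_of x)).2 (conj xinj erefl).
have tr : transitive (fun a b => letter_val x a < letter_val x b).
  by move=> ? ? ?; apply: lt_trans.
have := sorted_filter tr (fun a => letter_val x a < 0) srt.
have : forall a, (a \in [seq a <- sketch_of x | letter_val x a < 0]) = (letter_val x a < 0).
  by move=> a; rewrite mem_filter (perm_mem pw) mem_enum andbT.
move: [seq _ <- _ | _] => N inN sN; split=> [[u [c [e cb]]]|[a [a0 ab amax]]].
  case/lastP: N e inN sN => [|N a]; first by case: u.
  rewrite map_rcons => /rcons_inj[_ ca] inN.
  rewrite sorted_pairwise // pairwise_rcons => /andP[/allP Na _].
  exists a; split; rewrite ?ca //; first by rewrite -inN mem_rcons mem_head.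
  by move=> b; rewrite -inN mem_rcons inE => /orP[/eqP->//|/Na/ltW].
have aN : a \in N by rewrite inN.
have amaxN b : b \in N -> letter_val x b <= letter_val x a by rewrite inN; apply: amax.
have [N' ->] := last_maximum sN aN amaxN.
by exists (map (@ab_of_letter n) N'), (ab_of_letter a); rewrite map_rcons.
Qed.

(** These are the alphas preceding the pointed beta: the constant -3/2 and one letter of value
    [- mag x i - 1 / 2] per coordinate, the other alphas having value [mag x i - 1 / 2]. Hence the
    alpha of rank [n.+1] is the last one before the pointed beta. *)
Lemma card_small_alphas (R : realType) n (x : 'rV[R]_n) : distinct x ->
  #|[pred a | is_alpha (ab_of_letter a) & letter_val x a < - (1 / 2)]| = n.+1.
Proof.
move=> dx; have [x0 _] := dx.
pose h i := abs_letter (0 < centred x i) i false false.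
have hinj : injective h.
  move=> i j; apply: contra_eq => ij.
  exact: (abs_letter_neq (fun i => 0 < centred x i) false false false false ij).
rewrite (_ : #|_| = #|minus_three_halves |: [set h i | i in 'I_n]|); last first.
  apply: eq_card => a; rewrite !inE.
  apply/andP/orP => [[al va]|[/eqP->|/imsetP[i _ ->]]].
  - case: (abs_letterP (fun i => 0 < centred x i) a) al va => [[i [s [t ->]]]|].
      rewrite ab_of_abs_letter letter_val_abs // /abs_val; case: t => // _.
      have := mag_pos i dx; case: s => [|_ _]; first by lra.
      by right; apply: imset_f.
    by case=> -> //; left.
  - by split => //=; lra.
  - rewrite ab_of_abs_letter letter_val_abs // /abs_val; split => //.
    by have := mag_pos i dx; lra.
rewrite cardsU1 card_imset // card_ord (_ : _ \notin _) ?add1n //.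
by apply/imsetP => -[i _]; rewrite /h /abs_letter; case: ifP.
Qed.

Lemma pointed_sketch (R : realType) n (x : 'rV[R]_n) :
  injective (letter_val x) -> distinct x ->
  (exists u v, ab_word (sketch_of x) = u ++ [:: alpha, pointed_beta & v] /\
    count is_alpha u = n) <->
  exists a, [/\ letter_val x a < - (1 / 2), is_alpha (ab_of_letter a) &
    forall b, letter_val x b < - (1 / 2) -> letter_val x b <= letter_val x a].
Proof.
move=> xinj dx; rewrite ab_word_negative //.
have [pw srt] := (sorted_sketchP x (sketch_of x)).2 (conj xinj erefl).
have tr : transitive (fun a b => letter_val x a < letter_val x b).
  by move=> ? ? ?; apply: lt_trans.
have := sorted_filter tr (fun a => letter_val x a < 0) srt.
have : forall a, (a \in [seq a <- sketch_of x | letter_val x a < 0]) = (letter_val x a < 0).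
  by move=> a; rewrite mem_filter (perm_mem pw) mem_enum andbT.
have cN : count [pred a | is_alpha (ab_of_letter a) & letter_val x a < - (1 / 2)]
    [seq a <- sketch_of x | letter_val x a < 0] = n.+1.
  rewrite -(card_small_alphas dx) count_filter (permP pw) enumT cardE /enum_mem size_filter.
  apply: eq_count => a /=; rewrite !inE.
  have [h|h] := ltP (letter_val x a) (- (1 / 2)); last by rewrite !andbF.
  by rewrite (_ : letter_val x a < 0) ?andbT //; lra.
move: [seq _ <- _ | _] cN => N cN inN sN.
split=> [[u [v [e _]]]|[a [va al amax]]].
  have eN := cat_take_drop (size u) N.
  have := congr1 (drop (size u)) e; rewrite -map_drop drop_size_cat //.
  case: (drop _ N) eN => [//|a [//|m q]] eN /= [aa mp _].
  have {mp} mE : m = minus_half by case: (m) mp => [? []|? []||||].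
  rewrite {}mE in eN; move: inN sN; rewrite -eN sorted_pairwise // => inN.
  rewrite pairwise_cat allrel_consr => /and3P[/andP[/allP pa _] _].
  rewrite [pairwise _ _]/= => /and3P[/andP[va _] /allP vq _].
  exists a; split; [exact: va | by rewrite aa | move=> b vb].
  have : letter_val x b < 0 by lra.
  rewrite -inN mem_cat !inE => /orP[/pa/ltW //|/or3P[/eqP->//|/eqP bE|/vq /= h]].
    by rewrite bE /= ltxx in vb.
  by lra.
(* Cut at the pointed beta: [p] holds the letters below -1/2, among them [n.+1] alphas by [cN], and
   ends with [a], so that [n] alphas remain before [a]. *)
have /splitPr Nm : minus_half \in N by rewrite inN /=; lra.
case: {N} Nm cN inN sN => p q cN inN; rewrite sorted_pairwise // pairwise_cat.
rewrite allrel_consr -/(sorted _ _) => /and3P[/andP[/allP pm _] sp].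
rewrite [pairwise _ _]/= => /andP[/allP mq _].
have inp b : (b \in p) = (letter_val x b < - (1 / 2)).
  apply/idP/idP => [/pm //|vb]; have : letter_val x b < 0 by lra.
  rewrite -inN mem_cat inE => /or3P[//|/eqP bE|/mq /= h]; last by lra.
  by rewrite bE /= ltxx in vb.
have ap : a \in p by rewrite inp.
have amaxp b : b \in p -> letter_val x b <= letter_val x a by rewrite inp; apply: amax.
have [|p' pE] := @last_maximum _ _ (letter_val x) p a _ ap amaxp; first by rewrite sorted_pairwise.
exists (map (@ab_of_letter n) p'), (map (@ab_of_letter n) q).
have aa : ab_of_letter a = alpha by case: ab_of_letter al.
split; first by rewrite pE map_cat map_rcons /= aa cat_rcons.
move: cN; rewrite count_cat /= add0n.
rewrite (_ : count _ q = 0%N) ?addn0; last first.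
  apply/eqP; rewrite -leqn0 leqNgt -has_count; apply/hasPn => b /mq /= h.
  by apply/nandP; right; rewrite -leNgt ltW.
rewrite (@eq_in_count _ _ (is_alpha \o (@ab_of_letter n)) p); last first.
  by move=> b; rewrite inp /= => ->; rewrite andbT.
by rewrite pE -cats1 count_cat /= aa /= addn0 addn1 count_map => -[].
Qed.

(** * The two word conditions in terms of magnitudes *)

Lemma sketch_agree_neq (R : realType) n (x : 'rV[R]_n) : sketch_agree x x ->
  (forall i, [/\ 0 < mag x i, mag x i != 1, mag x i != 1 / 2 & mag x i != 2]) /\
  (forall i j, i != j -> mag x i + 1 != mag x j /\ mag x i + mag x j != 1).
Proof.
move=> sx; have /sketch_agreexx[dx _ _] := sx; case: sx => -[S1 S2] S3; split=> [i|i j ij].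
  have [_ /agreexx h1] := S1 i; have [/agreexx h2 /agreexx h3] := S3 i.
  by rewrite !subr_eq0 in h1 h2 h3; split => //; apply: mag_pos.
rewrite eq_sym in ij; have [_ /agreexx h1 /agreexx h2] := S2 j i ij.
by move: h1 h2; rewrite !neq_lt; lra.
Qed.

(** The values between -1/2 and 0 are [1/2 - m], a beta, for magnitudes [m] between 1/2 and 1, and
    [m - 1/2], an alpha, for [m] below 1/2. If there are none, the pointed beta comes last;
    otherwise some [1/2 - m] has to exceed all the others. *)
Lemma last_beta_mags (R : realType) n (x : 'rV[R]_n) : sketch_agree x x ->
  (exists a, [/\ letter_val x a < 0, is_beta (ab_of_letter a) &
     forall b, letter_val x b < 0 -> letter_val x b <= letter_val x a]) <->
  (forall k, (k < n)%N -> 1 < mags x k) \/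
  exists2 i, (i < n)%N & 1 / 2 < mags x i < 1 /\ forall j, (j < n)%N ->
    if mags x j < 1 / 2 then mags x i + mags x j < 1 else mags x i <= mags x j.
Proof.
move=> sx; have [m1 m2] := sketch_agree_neq sx.
have /sketch_agreexx[[x0 _] _ _] := sx.
pose e i := 0 < centred x i.
have vE i s t : letter_val x (abs_letter (e i) i s t) = abs_val (mag x i) s t.
  exact: letter_val_abs.
split=> [[a [a0 ab amax]]|].
  case: (abs_letterP e a) a0 ab amax => [[i [s [t ->]]]|]; last first.
    case=> -> //= a0 _ amax; last by lra.
      left=> k /(index_mag_order_surj x)[i ->]; rewrite mags_index.
      have := amax (abs_letter (e i) i false true).
      have := amax (abs_letter (e i) i true false).
      have [+ + + _] := m1 i; rewrite !vE /abs_val !neq_lt /= => p /orP[] p1 /orP[] p2 //.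
        by move=> /(_ ltac:(lra)); lra.
      by move=> _ /(_ ltac:(lra)); lra.
    by lra.
  rewrite ab_of_abs_letter vE /abs_val; case: t => // a0 _ amax.
  have [p n1 nhalf _] := m1 i.
  case: s a0 amax => a0 amax; first by exfalso; lra.
  right; exists (index i (mag_order x)); first exact: index_mag_order_lt.
  have i1 : mag x i < 1.
    by have := amax minus_half; move: n1; rewrite neq_lt /=; lra.
  rewrite mags_index; split; first by lra.
  move=> k /(index_mag_order_surj x)[j ->]; rewrite mags_index.
  have [q _ jhalf _] := m1 j.
  have := amax (abs_letter (e j) j false true); have := amax (abs_letter (e j) j true false).
  rewrite !vE /abs_val /=; case: (ltP (mag x j) (1 / 2)) => h; last first.
    by move=> _ /(_ ltac:(move: jhalf; rewrite neq_lt; lra)); lra.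
  move=> /(_ ltac:(lra)) h1 _; have [ij|ij] := eqVneq i j; first by rewrite -ij in h; lra.
  by have [_] := m2 i j ij; rewrite neq_lt; lra.
case=> [all1|[k kn [yk ymin]]].
  exists minus_half; split => //=; first by lra.
  move=> b; case: (abs_letterP e b) => [[j [s [t ->]]]|[] -> /=]; [|lra..].
  have := all1 _ (index_mag_order_lt x j); rewrite mags_index vE /abs_val.
  by case: s t => [] []; lra.
have [i kE] := index_mag_order_surj x kn; rewrite kE mags_index in yk ymin.
exists (abs_letter (e i) i false true); rewrite ab_of_abs_letter vE /abs_val; split => //.
  by lra.
move=> b; case: (abs_letterP e b) => [[j [s [t ->]]]|[] -> /=]; [|lra..].
have := ymin _ (index_mag_order_lt x j); rewrite mags_index vE /abs_val.
have [q _ _ _] := m1 j.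
by case: (ltP (mag x j) (1 / 2)) => h; case: s t => [] []; lra.
Qed.

(** With [y] the least magnitude, the largest alpha below -1/2 has value [- min(y, 1) - 1/2], and
    the betas there have values [1/2 - m] for magnitudes [m > 1]. The alpha is the greater one
    exactly when [m > 1 + min(y, 1)]. *)
Lemma pointed_mags (R : realType) n (x : 'rV[R]_n) : sketch_agree x x ->
  (exists a, [/\ letter_val x a < - (1 / 2), is_alpha (ab_of_letter a) &
     forall b, letter_val x b < - (1 / 2) -> letter_val x b <= letter_val x a]) <->
  forall k, (k < n)%N -> 1 < mags x k -> 1 + Num.min (mags x 0%N) 1 < mags x k.
Proof.
move=> sx; have [m1 m2] := sketch_agree_neq sx.
have /sketch_agreexx[dx _ _] := sx; have [x0 _] := dx; have yinc := mags_increasing dx.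
pose e i := 0 < centred x i.
have vE i s t : letter_val x (abs_letter (e i) i s t) = abs_val (mag x i) s t.
  exact: letter_val_abs.
have y0le i : mags x 0%N <= mag x i.
  rewrite -mags_index; apply: increasing_leq yinc _; exact: index_mag_order_lt.
split=> [[a [a0 aa amax]] k kn|h].
  have [j kE] := index_mag_order_surj x kn; rewrite kE mags_index => j1.
  have jbeta := amax (abs_letter (e j) j false true).
  have [_ _ _ j2] := m1 j.
  case: (abs_letterP e a) a0 aa amax jbeta => [[i [s [t ->]]]|]; last first.
    case=> -> //= _ _ _; rewrite vE /abs_val => /(_ ltac:(lra)) hj.
    have : Num.min (mags x 0%N) 1 <= 1 by rewrite ge_min lexx orbT.
    by move: j2; rewrite neq_lt; lra.
  rewrite ab_of_abs_letter vE /abs_val; case: t => // + _.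
  have [p _ _ _] := m1 i; case: s => [|_ amax]; first by lra.
  rewrite vE /abs_val => /(_ ltac:(lra)) hj.
  have := amax minus_three_halves; rewrite /= => /(_ ltac:(lra)) i1.
  have ij : i != j by apply: contraTneq j1 => <-; rewrite -leNgt; lra.
  have := y0le i; have : Num.min (mags x 0%N) 1 <= mags x 0%N by rewrite ge_min lexx.
  by have [+ _] := m2 i j ij; rewrite neq_lt; lra.
have hm i : 1 < mag x i -> 1 + Num.min (mags x 0%N) 1 < mag x i.
  by have := h _ (index_mag_order_lt x i); rewrite mags_index.
(* If some magnitude is below 1, the largest alpha belongs to the smallest magnitude; otherwise it
   is the constant -3/2. *)
have [[i i1]|no] := pselect (exists i, mag x i < 1).
  have n0 : (0 < n)%N by apply: leq_ltn_trans (ltn_ord i).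
  have [j jE] := index_mag_order_surj x n0.
  have jE' : mags x 0%N = mag x j by rewrite {1}jE mags_index.
  have j1 : mag x j < 1 by rewrite -jE'; apply: le_lt_trans i1.
  exists (abs_letter (e j) j false false); rewrite ab_of_abs_letter vE /abs_val.
  have [p _ _ _] := m1 j; split => //; first by lra.
  move=> b; case: (abs_letterP e b) => [[k [s [t ->]]]|[] -> /=]; [|lra..].
  have := y0le k; rewrite jE' vE /abs_val => jk; have := hm k.
  rewrite jE' min_l => [hk|]; last exact: ltW.
  case: s t => [] [] ?; [lra|lra| |lra].
  by have := hk ltac:(lra); lra.
have big i : 1 < mag x i.
  have [_ + _ _] := m1 i; rewrite neq_lt => /orP[i1|//].
  by case: no; exists i.
exists minus_three_halves; split => //=; first by lra.
move=> b; case: (abs_letterP e b) => [[k [s [t ->]]]|[] -> /=]; [|lra..].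
rewrite vE /abs_val; have := hm k (big k).
have k1 := big k; rewrite min_r; last first.
  have kn : (0 < n)%N by apply: leq_ltn_trans (ltn_ord k).
  by have [j jE] := index_mag_order_surj x kn; rewrite {1}jE mags_index ltW.
by case: s t => [] []; lra.
Qed.

Lemma sketch_agree_inj (R : realType) n (x : 'rV[R]_n) :
  sketch_agree x x <-> injective (letter_val x).
Proof. by rewrite -letters_agreexx letters_agreeP. Qed.

Lemma type_B_sketchesE (R : realType) n :
  type_B_sketches R n = @sketch_of R n @` [set x | distinct x /\ sketch_seq n (mags x)].
Proof.
apply/seteqP; split=> [w [[pw [x sw]] lastw ptw]|_ [x [dx ss] <-]].
  have [xinj wE] := (sorted_sketchP x w).1 (conj pw sw); exists x => //.
  rewrite wE in lastw ptw.
  have sx := (sketch_agree_inj x).2 xinj; have /sketch_agreexx[dx gx hx] := sx.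
  split => //; split => //.
    by apply/pointed_mags => //; apply/pointed_sketch.
  by apply/last_beta_mags => //; apply/last_beta_sketch.
have [gx hx y0 yc] := ss.
have sx : sketch_agree x x by apply/sketch_agreexx.
have xinj := (sketch_agree_inj x).1 sx.
have [pw sw] := (sorted_sketchP x (sketch_of x)).2 (conj xinj erefl).
split; first by split => //; exists x.
  by apply/last_beta_sketch => //; apply/last_beta_mags.
by apply/pointed_sketch => //; apply/pointed_mags.
Qed.

Lemma sketch_seq_ext (R : realFieldType) n (y y' : nat -> R) :
  (forall k, (k < n)%N -> y k = y' k) -> sketch_seq n y -> sketch_seq n y'.
Proof.
move=> yy' [gy hy y0 yc]; split=> [|k kn|k kn|].
- exact: generic_seq_ext gy.
- by rewrite -yy' //; apply: hy.
- by rewrite -!yy' //; [apply: y0 | apply: leq_ltn_trans kn].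
case: yc => [all1|[i in_ [yi yj]]].
  by left=> k kn; rewrite -yy' //; apply: all1.
by right; exists i => //; rewrite -yy' //; split => // j jn; rewrite -yy' //; apply: yj.
Qed.

Lemma card_type_B_sketches (R : realType) n :
  type_B_sketches R n #= `I_(2 ^ n * n`! * 'C(2 * n, n))%N.
Proof.
rewrite type_B_sketchesE; apply: (card_signed_classes (code := sketch_code n)).
- by move=> y [[yinc ypos _ _] _ _ _]; split => // k /ypos[].
- by move=> y [gy _ _ _]; apply: sketch_code_mem.
- exact: sketch_code_surj.
- move=> y y' yy' sy; have sy' := sketch_seq_ext yy' sy; split => //.
  apply/sketch_codeP => //; split; first exact: same_region_ext.
    by move=> k kn; rewrite yy'.
  by move=> k kn; rewrite yy'.
- move=> x x' dx ss dx' ss'; have [gx hx _ _] := ss; have [gx' hx' _ _] := ss'.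
  have sx : sketch_agree x x by apply/sketch_agreexx.
  have sx' : sketch_agree x' x' by apply/sketch_agreexx.
  have xinj := (sketch_agree_inj x).1 sx; have xinj' := (sketch_agree_inj x').1 sx'.
  rewrite sketch_of_eq // letters_agreeP.
  split=> [/(sketch_agreeP sx sx')[sE oE /(sketch_codeP ss ss') cE]|] //.
  by move=> [sE oE /(sketch_codeP ss ss') cE]; apply/sketch_agreeP.
Qed.

Theorem theorem5p12 (R : realType) (n : nat) (hn : (1 <= n)%N) :
  (type_B_sketches R n #= `I_(2 ^ n * n`! * 'C(2 * n, n))%N) /\
  (regions (arrangement_B R n) #= `I_(2 ^ n * n`! * 'C(2 * n, n))%N).
Proof. by split; [apply: card_type_B_sketches | apply: card_regions_B]. Qed.
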